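(* Let $p$ be a prime, $n \ge 0$, and suppose $k$ is a clarified field-like $C_{p^n}$-Tambara functor (so that $k(C_{p^n}/e)$ is a field). Suppose that either 1. the characteristic of $k(C_{p^n}/e)$ is not $p$, or 2. the fixed-point field $k(C_{p^n}/e)^{C_{p^n}}$ is perfect. Then $k$ is canonically isomorphic to the fixed-point Tambara functor associated to the $C_{p^n}$-ring $k(C_{p^n}/e)$; i.e. for every $0\le i\le n$ the restriction map $k(C_{p^n}/C_{p^i}) \to k(C_{p^n}/e)$ determines an isomorphism $k(C_{p^n}/C_{p^i}) \to k(C_{p^n}/e)^{C_{p^i}}$.
   Context: For a finite group $G$, a $G$-Tambara functor $k$ assigns to each finite $G$-set $X$ a commutative ring $k(X)$ (taking disjoint unions to products) and to each map $X \to Y$ of finite $G$-sets a restriction $k(Y)\to k(X)$ (a ring map), an additive transfer $k(X)\to k(Y)$ and a multiplicative norm $k(X)\to k(Y)$, satisfying the standard axioms (as in Tambara, Strickland). The Weyl group $N_GH/H$ acts on $k(G/H)$, in particular $G$ acts on $k(G/e)$. A nonzero $G$-Tambara functor $k$ is field-like if every morphism $k \to \ell$ with $\ell \neq 0$ is monic. (Nakaoka: equivalently, all restriction maps of $k$ are injective and $k(G/e)$ is nonzero with no nontrivial $G$-invariant ideals.) For $H\subset G$ and an $H$-ring $R$ (a commutative ring with $H$-action), $\mathrm{Coind}_H^G R=\mathrm{Fun}(G/H,R)$ is the coinduced $G$-ring (value of the right adjoint to restriction of rings with action). A field-like $k$ is separated if $k(G/e) \cong \mathrm{Coind}_H^G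 R$ as $G$-rings for some proper subgroup $H$ and $H$-ring $R$; otherwise it is clarified. (Equivalently, a field-like $k$ is clarified iff $k(G/e)$ is a field.) For a $G$-ring $R$, the fixed-point Tambara functor $\underline{R}$ has $\underline{R}(G/H)=R^H$, with restrictions the inclusions and transfers (resp. norms) the sums (resp. products) over cosets. The functor $R\mapsto\underline R$ is right adjoint to $k\mapsto k(G/e)$, and the canonical map $k\to\underline{k(G/e)}$ is the unit of this adjunction. *)

(* Defs.v *)
From HB Require Import structures.
From mathcomp Require Import all_boot all_order all_algebra all_fingroup all_solvable.

Set Implicit Arguments.
Unset Strict Implicit.
Unset Printing Implicit Defensive.

Import GRing.Theory.
Local Open Scope ring_scope.

(* Group actions follow the library: they are right actions, so finite G-sets
   are finite right G-sets, G/H is the set of right cosets H :* x, and G acts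
   on G/e = G by right multiplication.  Passing to inverses identifies this
   with the left-handed convention.  The ambient group is the whole type gT. *)

(* Only the values of the action at elements of D are meaningful. *)
Record gring (gT : finGroupType) (D : {set gT}) := GRingAct {
  gring_sort :> comPzRingType;
  gring_act : action D gring_sort;
  gring_actB : forall a, a \in D -> zmod_morphism (gring_act^~ a);
  gring_actM : forall a, a \in D -> monoid_morphism (gring_act^~ a) }.

Section GRingTheory.
Variables (gT : finGroupType) (D : {set gT}) (R : gring D) (a : gT).
Hypothesis Da : a \in D.
Implicit Types x y : R.

Lemma gactB x y : gring_act R (x - y) a = gring_act R x a - gring_act R y a.
Proof. exact: gring_actB. Qed.

Lemma gact1 : gring_act R 1 a = 1.
Proof. by case: (gring_actM R Da). Qed.

Lemma gactM x y : gring_act R (x * y) a = gring_act R x a * gring_act R y a.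
Proof. by case: (gring_actM R Da) => _; apply. Qed.

Lemma gact0 : gring_act R 0 a = 0.
Proof. by rewrite -[in LHS](subrr 0) gactB subrr. Qed.

Lemma gactD x y : gring_act R (x + y) a = gring_act R x a + gring_act R y a.
Proof. by rewrite -[y in LHS]opprK -(sub0r y) !gactB gact0 sub0r opprK. Qed.

Lemma gact_sum (I : finType) (P : pred I) (F : I -> R) :
  gring_act R (\sum_(i | P i) F i) a = \sum_(i | P i) gring_act R (F i) a.
Proof. by apply: (big_morph (gring_act R ^~ a)); [exact: gactD | exact: gact0]. Qed.

Lemma gact_prod (I : finType) (P : pred I) (F : I -> R) :
  gring_act R (\prod_(i | P i) F i) a = \prod_(i | P i) gring_act R (F i) a.
Proof. by apply: (big_morph (gring_act R ^~ a)); [exact: gactM | exact: gact1]. Qed.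

End GRingTheory.

Section EquivariantMaps.
Variables (gT : finGroupType) (D : {set gT}) (X : finType).
Variables (toX : X -> gT -> X) (R : gring D).

Definition equivariant (u : {ffun X -> R}) :=
  [forall x, forall (a | a \in D), u (toX x a) == gring_act R (u x) a].

Record eqvmap := EqvMap {
  eqvmap_val :> {ffun X -> R};
  eqvmapP : equivariant eqvmap_val }.

HB.instance Definition _ := [isSub for eqvmap_val].
HB.instance Definition _ := [Choice of eqvmap by <:].

Lemma equivariantP (u : {ffun X -> R}) :
  reflect (forall x a, a \in D -> u (toX x a) = gring_act R (u x) a)
          (equivariant u).
Proof.
apply: (iffP forallP) => [h x a Da | h x].
  by have /forall_inP /(_ a Da) /eqP := h x.
by apply/forall_inP => a Da; rewrite h.
Qed.

Lemma equivariant_subring : subring_closed equivariant.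
Proof.
split=> [|u v /equivariantP hu /equivariantP hv|u v /equivariantP hu /equivariantP hv];
  apply/equivariantP => x a Da; rewrite !ffunE.
- by rewrite gact1.
- by rewrite hu // hv // gactB.
- by rewrite hu // hv // gactM.
Qed.

HB.instance Definition _ :=
  GRing.SubChoice_isSubPzRing.Build {ffun X -> R} equivariant eqvmap
    equivariant_subring.

Lemma eqvmap_mulC : commutative (@GRing.mul eqvmap).
Proof.
by move=> u v; apply/val_inj/ffunP => x; rewrite /= !ffunE mulrC.
Qed.

HB.instance Definition _ :=
  GRing.PzRing_hasCommutativeMul.Build eqvmap eqvmap_mulC.

End EquivariantMaps.

(* The coinduced G-ring is the right adjoint of restriction: H-equivariant
   maps u : G -> R, u (x * h) = (u x)^h, with (u^g) x = u (g * x); the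
   counit is u |-> u 1.  As a ring it is Fun(G/H, R). *)
Section Coinduction.
Variables (gT : finGroupType) (H : {group gT}) (R : gring H).

Let M := eqvmap (fun x a : gT => (x * a)%g) R.

Fact coind_act_subproof (u : M) (g : gT) :
  equivariant (fun x a : gT => (x * a)%g) [ffun x => (u : {ffun gT -> R}) (g * x)%g].
Proof.
apply/equivariantP => x a Ha; rewrite !ffunE mulgA.
by have /equivariantP -> := eqvmapP u.
Qed.

Definition coind_act (u : M) (g : gT) : M := EqvMap (coind_act_subproof u g).

Fact coind_act1 : coind_act^~ 1%g =1 id.
Proof. by move=> u; apply/val_inj/ffunP => x; rewrite /= ffunE mul1g. Qed.

Fact coind_actM u : act_morph coind_act u.
Proof. by move=> a b; apply/val_inj/ffunP => x; rewrite /= !ffunE mulgA. Qed.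

Fact coind_gactB a : a \in [set: gT] ->
  zmod_morphism (TotalAction coind_act1 coind_actM ^~ a).
Proof. by move=> _ u v; apply/val_inj/ffunP => x; rewrite /= !ffunE. Qed.

Fact coind_gactM a : a \in [set: gT] ->
  monoid_morphism (TotalAction coind_act1 coind_actM ^~ a).
Proof. by move=> _; split=> [|u v]; apply/val_inj/ffunP => x; rewrite /= !ffunE. Qed.

Definition coind : gring [set: gT] := GRingAct coind_gactB coind_gactM.

End Coinduction.

Section FixedRing.
Variables (gT : finGroupType) (R : gring [set: gT]) (H : {set gT}).

Definition is_fixed (x : R) := [forall (a | a \in H), gring_act R x a == x].

Record fixed_ring := FixedElt { fixed_val :> R; fixedP : is_fixed fixed_val }.

HB.instance Definition _ := [isSub for fixed_val].
HB.instance Definition _ := [Choice of fixed_ring by <:].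

Lemma fixed_subring : subring_closed is_fixed.
Proof.
split=> [|x y /forall_inP hx /forall_inP hy|x y /forall_inP hx /forall_inP hy];
  apply/forall_inP => a Ha.
- by rewrite gact1 ?inE.
- by rewrite gactB ?inE // (eqP (hx a Ha)) (eqP (hy a Ha)).
- by rewrite gactM ?inE // (eqP (hx a Ha)) (eqP (hy a Ha)).
Qed.

HB.instance Definition _ :=
  GRing.SubChoice_isSubComPzRing.Build R is_fixed fixed_ring fixed_subring.

End FixedRing.

Definition is_field (K : comPzRingType) :=
  (1 : K) <> 0 /\ forall x : K, x <> 0 -> exists y, x * y = 1.

(* The library's [pchar K] requires 1 != 0 in the ring structure itself. *)
Definition has_pchar (K : comPzRingType) (q : nat) :=
  prime q /\ q%:R = 0 :> K.

(* Characteristic 0, or characteristic q > 0 with surjective Frobenius. *)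
Definition perfect_field (K : comPzRingType) :=
  is_field K /\
  forall q : nat, has_pchar K q -> forall x : K, exists y, y ^+ q = x.

Record gset (gT : finGroupType) := GSet {
  gset_sort :> finType;
  gset_act : {action gT &-> gset_sort} }.

Record gmap (gT : finGroupType) (X Y : gset gT) := GMap {
  gmap_fun :> X -> Y;
  gmap_eqv : forall x a, gmap_fun (gset_act X x a) = gset_act Y (gmap_fun x) a }.

Section GSets.
Variable gT : finGroupType.
Implicit Types X Y Z A P : gset gT.

Lemma gset_act1 X x : gset_act X x 1%g = x.
Proof. exact: act1. Qed.

Lemma gset_actM X x a b : gset_act X x (a * b)%g = gset_act X (gset_act X x a) b.
Proof. exact: actM. Qed.

Lemma gset_actK X a : cancel (gset_act X ^~ a) (gset_act X ^~ a^-1)%g.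
Proof. exact: actK. Qed.

Lemma gset_actKV X a : cancel (gset_act X ^~ a^-1)%g (gset_act X ^~ a).
Proof. exact: actKV. Qed.

Definition gid X : gmap X X := @GMap gT X X id (fun x a => erefl).

Fact gcomp_subproof X Y Z (g : gmap Y Z) (f : gmap X Y) x a :
  g (f (gset_act X x a)) = gset_act Z (g (f x)) a.
Proof. by rewrite !gmap_eqv. Qed.

Definition gcomp X Y Z (g : gmap Y Z) (f : gmap X Y) : gmap X Z :=
  GMap (gcomp_subproof g f).

Definition gempty : gset gT :=
  @GSet gT void (@TotalAction gT void (fun x _ => x) (fun=> erefl)
                   (fun _ _ _ => erefl)).

Section Coproduct.
Variables X Y : gset gT.

Definition gsum_act (z : X + Y) (a : gT) : X + Y :=
  match z with
  | inl x => inl (gset_act X x a)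
  | inr y => inr (gset_act Y y a)
  end.

Fact gsum_act1 : gsum_act^~ 1%g =1 id.
Proof. by case=> x /=; rewrite gset_act1. Qed.

Fact gsum_actM z : act_morph gsum_act z.
Proof. by case: z => x a b /=; rewrite gset_actM. Qed.

Definition gsum : gset gT := GSet (TotalAction gsum_act1 gsum_actM).

Definition ginl : gmap X gsum := @GMap gT X gsum inl (fun x a => erefl).
Definition ginr : gmap Y gsum := @GMap gT Y gsum inr (fun y a => erefl).

End Coproduct.

Definition is_pullback X Y Z P
    (p : gmap P X) (q : gmap P Y) (f : gmap X Z) (g : gmap Y Z) :=
  (forall w, f (p w) = g (q w)) /\
  (forall x y, f x = g y -> exists! w, p w = x /\ q w = y).

(* The dependent product of p : A -> X along f : X -> Y: its points over y are
   the sections of p over the fibre f^-1(y).  Such a section is encoded as a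
   total map s : X -> option A, equal to None outside the fibre. *)
Section DependentProduct.
Variables (X Y A : gset gT) (f : gmap X Y) (p : gmap A X).

Definition is_section (y : Y) (s : {ffun X -> option A}) :=
  [forall x, if s x is Some a then (f x == y) && (p a == x) else f x != y].

Definition dprod_sort :=
  {t : Y * {ffun X -> option A} | is_section t.1 t.2}.

Fact dprod_act_subproof (t : dprod_sort) (a : gT) :
  is_section (gset_act Y (val t).1 a)
    [ffun x => omap (gset_act A ^~ a) ((val t).2 (gset_act X x a^-1%g))].
Proof.
case: t => -[y s] /= /forallP hs; apply/forallP => x; rewrite ffunE.
have := hs (gset_act X x a^-1%g).
have fE : (f x == gset_act Y y a) = (f (gset_act X x a^-1%g) == y).
  by rewrite gmap_eqv (can2_eq (gset_actKV a) (gset_actK a)).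
case: (s _) => [b /= /andP[/eqP fb /eqP pb]|/=]; last by rewrite fE.
by rewrite fE fb eqxx /= gmap_eqv pb gset_actKV.
Qed.

Definition dprod_act (t : dprod_sort) (a : gT) : dprod_sort :=
  exist _ (gset_act Y (val t).1 a,
           [ffun x => omap (gset_act A ^~ a) ((val t).2 (gset_act X x a^-1%g))])
    (dprod_act_subproof t a).

Fact dprod_act1 : dprod_act^~ 1%g =1 id.
Proof.
case=> -[y s] hs; apply/val_inj; rewrite /= gset_act1; congr (_, _).
apply/ffunP => x; rewrite ffunE invg1 gset_act1.
by case: (s x) => //= b; rewrite gset_act1.
Qed.

Fact dprod_actM t : act_morph dprod_act t.
Proof.
case: t => -[y s] hs a b; apply/val_inj; rewrite /= gset_actM; congr (_, _).
apply/ffunP => x; rewrite !ffunE invMg gset_actM.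
by case: (s _) => //= c; rewrite gset_actM.
Qed.

Definition dprod : gset gT := GSet (TotalAction dprod_act1 dprod_actM).

Definition dprod_proj : gmap dprod Y :=
  @GMap gT dprod Y (fun t => (val t).1) (fun t a => erefl).

Definition dprod_section (t : dprod) : {ffun X -> option A} := (val t).2.

End DependentProduct.

(* G/e *)
Definition gfree : gset gT := @GSet gT gT 'R%act.

(* G/H *)
Section Orbit.
Variable H : {group gT}.

Definition coset_sort := {B : {set gT} | B \in rcosets H [set: gT]}.

Fact coset_act_subproof (B : coset_sort) (a : gT) :
  (val B :* a)%g \in rcosets H [set: gT].
Proof.
case: B => B /= /rcosetsP[x _ ->]; apply/rcosetsP; exists (x * a)%g; first by rewrite inE.
by rewrite rcosetM.
Qed.

Definition coset_act (B : coset_sort) (a : gT) : coset_sort :=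
  exist _ (val B :* a)%g (coset_act_subproof B a).

Fact coset_act1 : coset_act^~ 1%g =1 id.
Proof. by move=> B; apply/val_inj; rewrite /= mulg1. Qed.

Fact coset_actM B : act_morph coset_act B.
Proof. by move=> a b; apply/val_inj; rewrite /= rcosetM. Qed.

Definition gorbit : gset gT := GSet (TotalAction coset_act1 coset_actM).

Fact orbit_proj_subproof (x : gT) : (H :* x)%g \in rcosets H [set: gT].
Proof. by apply/rcosetsP; exists x; rewrite ?inE. Qed.

Fact orbit_proj_eqv (x a : gT) :
  exist _ (H :* (x * a))%g (orbit_proj_subproof (x * a)%g) =
  coset_act (exist _ (H :* x)%g (orbit_proj_subproof x)) a.
Proof. by apply/val_inj; rewrite /= rcosetM. Qed.

Definition orbit_proj : gmap gfree gorbit :=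
  @GMap gT gfree gorbit (fun x => exist _ (H :* x)%g (orbit_proj_subproof x))
    orbit_proj_eqv.

End Orbit.

(* The G-automorphisms of G/e are the left multiplications. *)
Definition lmul (g : gT) : gmap gfree gfree :=
  @GMap gT gfree gfree (fun x : gT => (g * x)%g) (fun x a => mulgA g x a).

Fact point_map_subproof X (x : X) (g a : gT) :
  gset_act X x (g * a)%g = gset_act X (gset_act X x g) a.
Proof. exact: gset_actM. Qed.

(* The G-map G/e -> X sending the identity to x. *)
Definition point_map X (x : X) : gmap gfree X :=
  @GMap gT gfree X (fun g : gT => gset_act X x g) (point_map_subproof x).

End GSets.

Arguments gempty {gT}.
Arguments gfree {gT}.

Record tambara (gT : finGroupType) := Tambara {
  tam :> gset gT -> comPzRingType;
  res : forall X Y, gmap X Y -> {rmorphism tam Y -> tam X};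
  tr : forall X Y, gmap X Y -> {additive tam X -> tam Y};
  nm : forall X Y, gmap X Y -> tam X -> tam Y;

  nm_monoid : forall X Y (f : gmap X Y), monoid_morphism (nm f);

  res_ext : forall X Y (f g : gmap X Y), f =1 g -> res f =1 res g;
  tr_ext : forall X Y (f g : gmap X Y), f =1 g -> tr f =1 tr g;
  nm_ext : forall X Y (f g : gmap X Y), f =1 g -> nm f =1 nm g;

  res_id : forall X, res (gid X) =1 id;
  tr_id : forall X, tr (gid X) =1 id;
  nm_id : forall X, nm (gid X) =1 id;
  res_comp : forall X Y Z (g : gmap Y Z) (f : gmap X Y),
    res (gcomp g f) =1 res f \o res g;
  tr_comp : forall X Y Z (g : gmap Y Z) (f : gmap X Y),
    tr (gcomp g f) =1 tr g \o tr f;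
  nm_comp : forall X Y Z (g : gmap Y Z) (f : gmap X Y),
    nm (gcomp g f) =1 nm g \o nm f;

  tam_empty : forall a : tam gempty, a = 0;
  tam_sum : forall X Y,
    bijective (fun a : tam (gsum X Y) => (res (ginl X Y) a, res (ginr X Y) a));

  tr_pullback : forall X Y Z P
      (p : gmap P X) (q : gmap P Y) (f : gmap X Z) (g : gmap Y Z),
    is_pullback p q f g -> forall a, res g (tr f a) = tr q (res p a);
  nm_pullback : forall X Y Z P
      (p : gmap P X) (q : gmap P Y) (f : gmap X Z) (g : gmap Y Z),
    is_pullback p q f g -> forall a, res g (nm f a) = nm q (res p a);

  (* Distributivity, for the exponential diagram
       X <-p- A <-e- E -f'-> dprod f p -q-> Y
     where E is the pullback of f along q and e is evaluation of sections. *)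
  nm_tr : forall X Y A E (f : gmap X Y) (p : gmap A X)
      (e : gmap E A) (pX : gmap E X) (f' : gmap E (dprod f p)),
    is_pullback pX f' f (dprod_proj f p) ->
    (forall t, dprod_section (f' t) (pX t) = Some (e t)) ->
    forall a, nm f (tr p a) = tr (dprod_proj f p) (nm f' (res e a)) }.

Arguments res {gT} t {X Y} f : rename.
Arguments tr {gT} t {X Y} f : rename.
Arguments nm {gT} t {X Y} f a : rename.

Record tmor (gT : finGroupType) (k l : tambara gT) := TMor {
  tmor_fun :> forall X, {rmorphism k X -> l X};
  tmor_res : forall X Y (f : gmap X Y) a,
    tmor_fun X (res k f a) = res l f (tmor_fun Y a);
  tmor_tr : forall X Y (f : gmap X Y) a,
    tmor_fun Y (tr k f a) = tr l f (tmor_fun X a);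
  tmor_nm : forall X Y (f : gmap X Y) a,
    tmor_fun Y (nm k f a) = nm l f (tmor_fun X a) }.

Section FieldLike.
Variable gT : finGroupType.
Implicit Types k l : tambara gT.

Definition tam_iso k l (phi : tmor k l) :=
  exists psi : tmor l k,
    forall X, cancel (phi X) (psi X) /\ cancel (psi X) (phi X).

Definition tam_monic k l (phi : tmor k l) :=
  forall (h : tambara gT) (a b : tmor h k),
    (forall X x, phi X (a X x) = phi X (b X x)) -> forall X, a X =1 b X.

Definition tam_nonzero k := exists X, (1 : k X) <> 0.

Definition field_like k :=
  tam_nonzero k /\ forall l (phi : tmor k l), tam_nonzero l -> tam_monic phi.

End FieldLike.

(* k(G/e) as a G-ring *)
Section Bottom.
Variables (gT : finGroupType) (k : tambara gT).

Definition bottom_act (x : k gfree) (g : gT) : k gfree := res k (lmul g) x.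

Fact bottom_act1 : bottom_act^~ 1%g =1 id.
Proof.
move=> x; rewrite -[RHS](res_id (t := k)); apply: res_ext => y; exact: mul1g.
Qed.

Fact bottom_actM x : act_morph bottom_act x.
Proof.
move=> a b; rewrite /bottom_act; have /= <- := res_comp (t := k) (lmul a) (lmul b) x.
by apply: res_ext => y /=; rewrite mulgA.
Qed.

Fact bottom_gactB a : a \in [set: gT] ->
  zmod_morphism (TotalAction bottom_act1 bottom_actM ^~ a).
Proof. by move=> _ x y; apply: rmorphB. Qed.

Fact bottom_gactM a : a \in [set: gT] ->
  monoid_morphism (TotalAction bottom_act1 bottom_actM ^~ a).
Proof. by move=> _; split=> [|x y]; [apply: rmorph1 | apply: rmorphM]. Qed.

Definition bottom_gring : gring [set: gT] := GRingAct bottom_gactB bottom_gactM.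

End Bottom.

Definition gring_isomorphic (gT : finGroupType) (D : {set gT}) (R S : gring D) :=
  exists phi : {rmorphism R -> S},
    bijective phi /\
    forall x a, a \in D -> phi (gring_act R x a) = gring_act S (phi x) a.

Definition separated (gT : finGroupType) (k : tambara gT) :=
  exists (H : {group gT}) (R : gring H),
    H \proper [set: gT] /\ gring_isomorphic (bottom_gring k) (coind R).

Definition clarified (gT : finGroupType) (k : tambara gT) := ~ separated k.

(* On an arbitrary finite G-set the fixed-point functor of R takes the value
   Map_G(X, R); evaluation at the coset H identifies Map_G(G/H, R) with R^H.
   Transfers and norms are sums and products over fibres. *)
Section FixedPointFunctor.
Variables (gT : finGroupType) (R : gring [set: gT]).
Implicit Types X Y Z A P : gset gT.

Definition fpt X : comPzRingType := eqvmap (gset_act X) R.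

Lemma fptE X (u : fpt X) x a :
  (u : {ffun X -> R}) (gset_act X x a) = gring_act R ((u : {ffun X -> R}) x) a.
Proof. by have /equivariantP -> := eqvmapP u; rewrite ?inE. Qed.

Lemma fptP X (u v : fpt X) :
  (u : {ffun X -> R}) =1 (v : {ffun X -> R}) -> u = v.
Proof. by move=> uv; apply/val_inj/ffunP. Qed.

Section Operations.
Variables (X Y : gset gT) (f : gmap X Y).

Fact fpt_res_subproof (u : fpt Y) :
  equivariant (gset_act X) [ffun x => (u : {ffun Y -> R}) (f x)].
Proof. by apply/equivariantP => x a _; rewrite !ffunE gmap_eqv fptE. Qed.

Definition fpt_res (u : fpt Y) : fpt X := EqvMap (fpt_res_subproof u).

Lemma fibre_act (y : Y) (a : gT) (x : X) :
  (f (gset_act X x a) == gset_act Y y a) = (f x == y).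
Proof. by rewrite gmap_eqv (inj_eq (can_inj (gset_actK a))). Qed.

Lemma act_bij (Z : gset gT) (a : gT) : bijective (gset_act Z ^~ a).
Proof. by exists (gset_act Z ^~ a^-1)%g; [exact: gset_actK | exact: gset_actKV]. Qed.

Fact fpt_tr_subproof (u : fpt X) :
  equivariant (gset_act Y) [ffun y => \sum_(x | f x == y) (u : {ffun X -> R}) x].
Proof.
apply/equivariantP => y a _; rewrite !ffunE gact_sum ?inE //.
rewrite (reindex _ (onW_bij _ (act_bij X a))).
by apply: eq_big => [x|x _]; rewrite ?fibre_act ?fptE.
Qed.

Definition fpt_tr (u : fpt X) : fpt Y := EqvMap (fpt_tr_subproof u).

Fact fpt_nm_subproof (u : fpt X) :
  equivariant (gset_act Y) [ffun y => \prod_(x | f x == y) (u : {ffun X -> R}) x].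
Proof.
apply/equivariantP => y a _; rewrite !ffunE gact_prod ?inE //.
rewrite (reindex _ (onW_bij _ (act_bij X a))).
by apply: eq_big => [x|x _]; rewrite ?fibre_act ?fptE.
Qed.

Definition fpt_nm (u : fpt X) : fpt Y := EqvMap (fpt_nm_subproof u).

Fact fpt_res_zmod : zmod_morphism fpt_res.
Proof. by move=> u v; apply: fptP => x; rewrite /= !ffunE. Qed.

Fact fpt_res_monoid : monoid_morphism fpt_res.
Proof. by split=> [|u v]; apply: fptP => x; rewrite /= !ffunE. Qed.

Fact fpt_tr_zmod : zmod_morphism fpt_tr.
Proof.
move=> u v; apply: fptP => y; rewrite /= !ffunE.
by rewrite -sumrB; apply: eq_bigr => x _; rewrite !ffunE.
Qed.

Fact fpt_nm_monoid : monoid_morphism fpt_nm.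
Proof.
split=> [|u v]; apply: fptP => y; rewrite /= !ffunE.
  by rewrite big1 // => x _; rewrite ffunE.
by rewrite -big_split; apply: eq_bigr => x _; rewrite !ffunE.
Qed.

HB.instance Definition _ :=
  GRing.isZmodMorphism.Build (fpt Y) (fpt X) fpt_res fpt_res_zmod.
HB.instance Definition _ :=
  GRing.isMonoidMorphism.Build (fpt Y) (fpt X) fpt_res fpt_res_monoid.
HB.instance Definition _ :=
  GRing.isZmodMorphism.Build (fpt X) (fpt Y) fpt_tr fpt_tr_zmod.

End Operations.

Fact fpt_res_ext X Y (f g : gmap X Y) : f =1 g -> fpt_res f =1 fpt_res g.
Proof. by move=> fg u; apply: fptP => x; rewrite /= !ffunE fg. Qed.

Fact fpt_tr_ext X Y (f g : gmap X Y) : f =1 g -> fpt_tr f =1 fpt_tr g.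
Proof.
by move=> fg u; apply: fptP => y; rewrite /= !ffunE; apply: eq_bigl => x; rewrite fg.
Qed.

Fact fpt_nm_ext X Y (f g : gmap X Y) : f =1 g -> fpt_nm f =1 fpt_nm g.
Proof.
by move=> fg u; apply: fptP => y; rewrite /= !ffunE; apply: eq_bigl => x; rewrite fg.
Qed.

Fact fpt_res_id X : fpt_res (gid X) =1 id.
Proof. by move=> u; apply: fptP => x; rewrite /= ffunE. Qed.

Fact fpt_tr_id X : fpt_tr (gid X) =1 id.
Proof. by move=> u; apply: fptP => x; rewrite /= ffunE big_pred1_eq. Qed.

Fact fpt_nm_id X : fpt_nm (gid X) =1 id.
Proof. by move=> u; apply: fptP => x; rewrite /= ffunE big_pred1_eq. Qed.

Fact fpt_res_comp X Y Z (g : gmap Y Z) (f : gmap X Y) :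
  fpt_res (gcomp g f) =1 fpt_res f \o fpt_res g.
Proof. by move=> u; apply: fptP => x; rewrite /= !ffunE. Qed.

Lemma fibre_comp (T : Type) (idx : T) (op : Monoid.com_law idx)
    (I J K : finType) (f : I -> J) (g : J -> K) (F : I -> T) (z : K) :
  \big[op/idx]_(i | g (f i) == z) F i =
  \big[op/idx]_(j | g j == z) \big[op/idx]_(i | f i == j) F i.
Proof.
rewrite (partition_big f (fun j => g j == z)) //=; apply: eq_bigr => j /eqP gj.
by apply: eq_bigl => i; rewrite andb_idl // => /eqP ->; rewrite gj.
Qed.

Fact fpt_tr_comp X Y Z (g : gmap Y Z) (f : gmap X Y) :
  fpt_tr (gcomp g f) =1 fpt_tr g \o fpt_tr f.
Proof.
move=> u; apply: fptP => z; rewrite /= !ffunE fibre_comp.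
by apply: eq_bigr => y _; rewrite ffunE.
Qed.

Fact fpt_nm_comp X Y Z (g : gmap Y Z) (f : gmap X Y) :
  fpt_nm (gcomp g f) =1 fpt_nm g \o fpt_nm f.
Proof.
move=> u; apply: fptP => z; rewrite /= !ffunE fibre_comp.
by apply: eq_bigr => y _; rewrite ffunE.
Qed.

Fact fpt_empty (a : fpt gempty) : a = 0.
Proof. by apply: fptP; case. Qed.

Fact fpt_glue_subproof X Y (u : fpt X) (v : fpt Y) :
  equivariant (gset_act (gsum X Y))
    [ffun z : gsum X Y => match z with
                          | inl x => (u : {ffun X -> R}) x
                          | inr y => (v : {ffun Y -> R}) y
                          end].
Proof. by apply/equivariantP => -[x|y] a _; rewrite !ffunE /= fptE. Qed.

Fact fpt_sum X Y :
  bijective (fun a : fpt (gsum X Y) =>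
               (fpt_res (ginl X Y) a, fpt_res (ginr X Y) a)).
Proof.
exists (fun uv => EqvMap (fpt_glue_subproof uv.1 uv.2)) => [a|[u v]].
  by apply: fptP => -[x|y]; rewrite /= !ffunE.
by congr (_, _); apply: fptP => x; rewrite /= !ffunE.
Qed.

Lemma fibre_pullback (T : Type) (idx : T) (op : Monoid.com_law idx) X Y Z P
    (p : gmap P X) (q : gmap P Y) (f : gmap X Z) (g : gmap Y Z)
    (F : X -> T) (y : Y) :
  is_pullback p q f g ->
  \big[op/idx]_(x | f x == g y) F x = \big[op/idx]_(w | q w == y) F (p w).
Proof.
case=> fpgq univ.
rewrite [RHS](partition_big p (fun x => f x == g y)) /=; last first.
  by move=> w /eqP <-; rewrite fpgq.
apply: eq_bigr => x /eqP fx.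
have [w [[pw qw] wuniq]] := univ x y fx.
rewrite (big_pred1 w) ?pw // => v /=.
apply/andP/eqP => [[/eqP qv /eqP pv]|->]; last by rewrite pw qw.
exact/esym/wuniq.
Qed.

Fact fpt_tr_pullback X Y Z P
    (p : gmap P X) (q : gmap P Y) (f : gmap X Z) (g : gmap Y Z) :
  is_pullback p q f g ->
  forall a, fpt_res g (fpt_tr f a) = fpt_tr q (fpt_res p a).
Proof.
move=> sq u; apply: fptP => y; rewrite /= !ffunE (fibre_pullback _ _ _ sq).
by apply: eq_bigr => w _; rewrite ffunE.
Qed.

Fact fpt_nm_pullback X Y Z P
    (p : gmap P X) (q : gmap P Y) (f : gmap X Z) (g : gmap Y Z) :
  is_pullback p q f g ->
  forall a, fpt_res g (fpt_nm f a) = fpt_nm q (fpt_res p a).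
Proof.
move=> sq u; apply: fptP => y; rewrite /= !ffunE (fibre_pullback _ _ _ sq).
by apply: eq_bigr => w _; rewrite ffunE.
Qed.

Fact fpt_nm_tr X Y A E (f : gmap X Y) (p : gmap A X)
    (e : gmap E A) (pX : gmap E X) (f' : gmap E (dprod f p)) :
  is_pullback pX f' f (dprod_proj f p) ->
  (forall t, dprod_section (f' t) (pX t) = Some (e t)) ->
  forall a, fpt_nm f (fpt_tr p a) =
            fpt_tr (dprod_proj f p) (fpt_nm f' (fpt_res e a)).
Proof.
move=> sq ev u; apply: fptP => y; rewrite /= !ffunE.
pose G (o : option A) : R := if o is Some a then (u : {ffun A -> R}) a else 0.
pose Q (x : X) : pred (option A) := fun o => if o is Some a then p a == x else false.
pose isec (t : Y * {ffun X -> option A}) := is_section f p t.1 t.2.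
transitivity (\prod_(x | f x == y) \sum_(o | Q x o) G o).
  apply: eq_bigr => x _; rewrite ffunE.
  rewrite [RHS](reindex_omap (Some : A -> option A) id) /=; last by case.
  by apply: eq_bigl => a; rewrite eqxx andbT.
rewrite (big_distr_big_dep None).
rewrite (reindex_omap (fun b : dprod_sort f p => (val b).2)
           (fun s => insub (y, s))) /=; last first.
  move=> s /pfamilyP[/supportP s0 sQ].
  have hs : is_section f p y s.
    apply/forallP => x; have [fx|fx] := boolP (f x == y).
      by have := sQ x fx; rewrite unfold_in /Q; case: (s x).
    by rewrite s0.
  by rewrite (@insubT _ isec _ (y, s) hs).
have secP (b : dprod_sort f p) x :
    (if (val b).2 x is Some a then (f x == (val b).1) && (p a == x)
     else f x != (val b).1) : bool.
  exact: (forallP (valP b) x).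
apply: eq_big => [b|b /andP[_]].
  apply/andP/eqP => [[/pfamilyP[_ bQ] hb]|<-].
    by move: hb; case: insubP => //= c _ cE /eqP[<-]; rewrite cE.
  split.
    apply/pfamilyP; split=> [|x fx].
      by apply/supportP => x; have := secP b x; case: ((val b).2 x) => // a /andP[fx _]; rewrite unfold_in fx.
    move: fx (secP b x); rewrite !unfold_in /Q.
    by case: ((val b).2 x) => [a _ /andP[]|->].
  rewrite /dprod_section /=; case: b => -[z s] hs /=.
  by rewrite (@insubT _ isec _ (z, s) hs) (bool_irrelevance hs _).
case: insubP => //= c _ cE /eqP[cb].
have yE : y = dprod_proj f p b by rewrite /= -cb cE.
rewrite ffunE yE (fibre_pullback _ _ _ sq).
by apply: eq_bigr => t /eqP <-; rewrite ev ffunE.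
Qed.

Definition fixed_point_tambara : tambara gT :=
  @Tambara gT fpt fpt_res fpt_tr fpt_nm
    fpt_nm_monoid fpt_res_ext fpt_tr_ext fpt_nm_ext
    fpt_res_id fpt_tr_id fpt_nm_id fpt_res_comp fpt_tr_comp fpt_nm_comp
    fpt_empty fpt_sum fpt_tr_pullback fpt_nm_pullback fpt_nm_tr.

End FixedPointFunctor.

(* The components of the unit k -> fixed_point_tambara (bottom_gring k) of the
   adjunction between k |-> k(G/e) and the fixed-point functor: a in k(X) goes
   to the map X -> k(G/e) sending x to the restriction of a along the G-map
   G/e -> X classifying x. *)
Definition is_unit_map (gT : finGroupType) (k : tambara gT)
    (phi : tmor k (fixed_point_tambara (bottom_gring k))) :=
  forall (X : gset gT) (a : k X) (x : X),
    eqvmap_val (phi X a) x = res k (point_map x) a.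

(* Main.v *)
From HB Require Import structures.
From mathcomp Require Import all_boot all_order all_algebra all_fingroup all_solvable.
From mathcomp Require Import boolp.
Require Import Defs.

(** Write R for k(G/e), a ring with G-action.

    Two reductions use test objects.  A monic morphism phi is injective at every
    level, because the two projections of its levelwise kernel pair become equal
    after phi ([monic_injective]).  Applied to the morphism k -> fixed points
    of S transposed from an equivariant theta : R -> S with S nonzero, this says
    that every such transpose is injective ([adjunct_injective]); hence the
    canonical map from k to the fixed points of R is injective at every level,
    and, taking S = R/I, R has no proper nonzero invariant ideal
    ([field_like_simple]).

    If such an R is not a field, let x be a nonzero nonunit.  The product of all
    conjugates of x is an invariant nonunit, so it is 0; take a maximal set S of
    group elements for which the product y of the x^s is still nonzero.  A
    translate of y is either y itself or orthogonal to y, and since the conjugates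
    of y generate the unit ideal, y is a multiple of y^2.  This gives an
    idempotent whose distinct conjugates are orthogonal and whose stabiliser H is
    a proper subgroup, and it exhibits R as coinduced from H
    ([simple_idempotent], [coinduced_from_idempotent]).  So R is a field when k
    is clarified.

    There remains surjectivity of the canonical map at a finite G-set X.  It holds
    on free G-sets, where k is a product of copies of R.  The action map
    X x G -> X has free source and all its fibres have |G| = p^n elements, so
    on fixed points restricting an equivariant w : X -> R along it and then
    transferring gives |G| w, while restricting and then taking norms gives
    w^|G|.  Both are images of elements of k.  If p is invertible in R the first
    kind exhausts all equivariant maps; if R has characteristic p and is perfect
    the second kind does.  Finally R inherits perfection from its fixed field K:
    interpolating z^p |-> z on the orbit of x gives a polynomial over K = K^p
    that expresses x through x^p ([perfect_over_fixed]). *)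

Set Implicit Arguments.
Unset Strict Implicit.
Unset Printing Implicit Defensive.

Import GRing.Theory.
Local Open Scope ring_scope.

(** * Tambara functors on free G-sets *)

Section FreeGSets.
Variable gT : finGroupType.
Implicit Types (X Y : gset gT) (k : tambara gT).

Section FreeOn.
Variable I : finType.

Definition free_act (x : I * gT) (a : gT) : I * gT := (x.1, (x.2 * a)%g).

Fact free_act1 : free_act^~ 1%g =1 id.
Proof. by case=> i g; rewrite /free_act mulg1. Qed.

Fact free_actM x : act_morph free_act x.
Proof. by move=> a b; rewrite /free_act mulgA. Qed.

Definition free_on : gset gT := GSet (TotalAction free_act1 free_actM).

Definition free_incl (i : I) : gmap gfree free_on :=
  @GMap gT gfree free_on (fun g : gT => (i, g)) (fun g a => erefl).

End FreeOn.

Lemma res_cancel k X Y (s : gmap X Y) (t : gmap Y X) :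
  cancel t s -> cancel (res k s) (res k t).
Proof.
move=> ts a; have /= <- := res_comp (t := k) s t a.
by rewrite -[RHS](res_id (t := k)); apply: res_ext => y; exact: ts.
Qed.

Arguments res_cancel k {X Y s t}.

Definition void_map X : gmap gempty X :=
  @GMap gT gempty X (fun v : void => match v with end)
    (fun v => match v with end).

(** A G-set without points is isomorphic to the empty one, where k vanishes. *)
Lemma tam_void k X (a b : k X) : (X -> False) -> a = b.
Proof.
move=> X0.
pose t : gmap X gempty := @GMap gT X gempty (fun x => False_rect _ (X0 x))
                            (fun x => False_rect _ (X0 x)).
have sK : cancel (res k (void_map X)) (res k t) by apply: res_cancel => x; case: (X0 x).
by rewrite -[a]sK -[b]sK (tam_empty (res k _ a)) (tam_empty (res k _ b)).
Qed.

Definition split_free n : gmap (free_on 'I_n.+1) (gsum gfree (free_on 'I_n)).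
Proof.
exists (fun x : 'I_n.+1 * gT => match unlift ord0 x.1 with
        | Some j => inr (j, x.2)
        | None => inl x.2 end : (gT + ('I_n * gT))%type).
by case=> i g a /=; case: (unlift ord0 i).
Defined.

Definition join_free n : gmap (gsum gfree (free_on 'I_n)) (free_on 'I_n.+1).
Proof.
exists (fun z : (gT + ('I_n * gT))%type => match z with
        | inl g => (ord0, g)
        | inr x => (lift ord0 x.1, x.2) end : 'I_n.+1 * gT).
by case.
Defined.

Lemma split_freeK n : cancel (@split_free n) (@join_free n).
Proof.
by case=> i g /=; case: unliftP => [j ->|->].
Qed.

Lemma join_freeK n : cancel (@join_free n) (@split_free n).
Proof.
by case=> [g|[i g]] /=; rewrite ?unlift_none ?liftK.
Qed.

(** By induction on n, since k turns disjoint unions into products: k takes the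
    free G-set on n points to the n-th power of k(G/e). *)
Lemma free_ord k n :
  (forall b b' : k (free_on 'I_n),
     (forall i, res k (free_incl i) b = res k (free_incl i) b') -> b = b') /\
  (forall c : 'I_n -> k gfree,
     exists b : k (free_on 'I_n), forall i, res k (free_incl i) b = c i).
Proof.
elim: n => [|n [ext glue]].
  split=> [b b' _|c]; first by apply: tam_void => -[[]].
  by exists 0 => -[].
have resJ (b : k (free_on 'I_n.+1)) :
    res k (ginl _ _) (res k (join_free n) b) = res k (free_incl ord0) b /\
    forall i, res k (free_incl i) (res k (ginr _ _) (res k (join_free n) b)) =
              res k (free_incl (lift ord0 i)) b.
  split=> [|i].
    by have /= <- := res_comp (t := k) (join_free n) (ginl _ _) b; apply: res_ext.
  have /= <- := res_comp (t := k) (join_free n) (ginr _ _) b.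
  have /= <- := res_comp (t := k) (gcomp (join_free n) (ginr _ _)) (free_incl i) b.
  exact: res_ext.
split=> [b b' bb'|c].
  apply: (can_inj (res_cancel k (@split_freeK n))).
  apply: (bij_inj (tam_sum k _ _)); congr (_, _).
    by rewrite (resJ b).1 (resJ b').1.
  by apply: ext => i; rewrite (resJ b).2 (resJ b').2.
have [b bE] := glue (c \o lift ord0).
have [h hK Kh] := tam_sum k gfree (free_on 'I_n).
have [hl hr] : res k (ginl _ _) (h (c ord0, b)) = c ord0 /\
               res k (ginr _ _) (h (c ord0, b)) = b.
  by have [] := Kh (c ord0, b).
exists (res k (split_free n) (h (c ord0, b))) => i.
case: (unliftP ord0 i) => [j|] ->.
  rewrite -(resJ _).2 (res_cancel k (@join_freeK n)) hr; exact: bE.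
by rewrite -(resJ _).1 (res_cancel k (@join_freeK n)) hl.
Qed.

Section FreeOnTheory.
Variables (I : finType) (k : tambara gT).

Let rank_map : gmap (free_on I) (free_on 'I_#|I|) :=
  @GMap gT (free_on I) (free_on 'I_#|I|)
    (fun x : I * gT => (enum_rank x.1, x.2)) (fun x a => erefl).

Let val_map : gmap (free_on 'I_#|I|) (free_on I) :=
  @GMap gT (free_on 'I_#|I|) (free_on I)
    (fun x : 'I_#|I| * gT => (enum_val x.1, x.2)) (fun x a => erefl).

Let rankK : cancel rank_map val_map.
Proof. by case=> i g /=; rewrite enum_rankK. Qed.

Let valK : cancel val_map rank_map.
Proof. by case=> i g /=; rewrite enum_valK. Qed.

Let res_val (b : k (free_on I)) j :
  res k (free_incl j) (res k val_map b) = res k (free_incl (enum_val j)) b.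
Proof.
by have /= <- := res_comp (t := k) val_map (free_incl j) b; apply: res_ext.
Qed.

Lemma free_ext (b b' : k (free_on I)) :
  (forall i, res k (free_incl i) b = res k (free_incl i) b') -> b = b'.
Proof.
move=> bb'; apply: (can_inj (res_cancel k rankK)).
by apply: (free_ord k _).1 => j; rewrite !res_val.
Qed.

Lemma free_glue (c : I -> k gfree) :
  exists b : k (free_on I), forall i, res k (free_incl i) b = c i.
Proof.
have [b bE] := (free_ord k #|I|).2 (fun j => c (enum_val j)).
exists (res k rank_map b) => i.
by rewrite -[i]enum_rankK -res_val (res_cancel k valK) bE.
Qed.

Let incl_square i :
  is_pullback (gid gfree) (gid gfree) (free_incl i) (@free_incl I i).
Proof.
by split=> // x y [->]; exists y; split=> // z [].
Qed.

Let void_square (i j : I) : i != j ->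
  is_pullback (void_map gfree) (void_map gfree) (free_incl i) (@free_incl I j).
Proof.
by move=> ij; split=> [[]|x y [ijE]]; rewrite ijE eqxx in ij.
Qed.

Lemma res_tr_incl i j (c : k gfree) :
  res k (free_incl j) (tr k (@free_incl I i) c) = if i == j then c else 0.
Proof.
case: eqVneq => [<-|ij].
  by rewrite (tr_pullback (incl_square i)) tr_id res_id.
by rewrite (tr_pullback (void_square ij)) (tam_empty (res k _ c)) raddf0.
Qed.

Lemma res_nm_incl i j (c : k gfree) :
  res k (free_incl j) (nm k (@free_incl I i) c) = if i == j then c else 1.
Proof.
case: eqVneq => [<-|ij].
  by rewrite (nm_pullback (incl_square i)) nm_id res_id.
rewrite (nm_pullback (void_square ij)) (tam_empty (res k _ c)).
by rewrite -(tam_empty (1 : k gempty)); case: (nm_monoid k (void_map gfree)).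
Qed.

(** An element of k(I x G) is the sum of the transfers of its restrictions to
    the copies of G, and also the product of their norms: all three elements
    have the same restrictions to the copies of G. *)
Lemma tr_free Y (q : gmap (free_on I) Y) b :
  tr k q b = \sum_i tr k (gcomp q (free_incl i)) (res k (free_incl i) b).
Proof.
rewrite [in LHS](_ : b = \sum_i tr k (free_incl i) (res k (free_incl i) b)).
  by rewrite raddf_sum; apply: eq_bigr => i _; rewrite tr_comp.
apply: free_ext => j; rewrite raddf_sum (bigD1 j) //= res_tr_incl eqxx.
by rewrite big1 ?addr0 // => i /negPf ij; rewrite res_tr_incl ij.
Qed.

Lemma nm_free Y (q : gmap (free_on I) Y) b :
  nm k q b = \prod_i nm k (gcomp q (free_incl i)) (res k (free_incl i) b).
Proof.
rewrite [in LHS](_ : b = \prod_i nm k (free_incl i) (res k (free_incl i) b)).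
  have [nm1 nmM] := nm_monoid k q.
  by rewrite (big_morph _ nmM nm1); apply: eq_bigr => i _; rewrite nm_comp.
apply: free_ext => j; rewrite rmorph_prod (bigD1 j) //= res_nm_incl eqxx.
by rewrite big1 ?mulr1 // => i /negPf ij; rewrite res_nm_incl ij.
Qed.

End FreeOnTheory.

Fact free_cover_subproof X (x : free_on X) a :
  gset_act X x.1 (x.2 * a)%g = gset_act X (gset_act X x.1 x.2) a.
Proof. exact: gset_actM. Qed.

(** The action map X x G -> X is equivariant for the action on the second
    factor, and presents any X as a quotient of a free G-set. *)
Definition free_cover X : gmap (free_on X) X :=
  @GMap gT (free_on X) X (fun x => gset_act X x.1 x.2) (@free_cover_subproof X).

(** The element 0 is the transfer of 0 from the empty G-set, and the
    distributivity law turns its norm into a transfer from the sections of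
    the empty map over the fibres of f; there are none if no fibre is empty. *)
Lemma nm_surj0 k X Y (f : gmap X Y) :
  (forall y, exists x, f x = y) -> nm k f 0 = 0.
Proof.
move=> fsurj.
have D0 : dprod f (void_map X) -> False.
  case=> -[y s] /= /forallP sP; have [x fx] := fsurj y.
  by have := sP x; case: (s x) => [[]|] /=; rewrite fx eqxx.
have := @nm_tr gT k X Y gempty gempty f (void_map X)
  (void_map _) (void_map _) (void_map _) _ _ 0.
rewrite raddf0 => ->.
- by rewrite (tam_void (nm k _ _) 0 D0) raddf0.
- by split=> [[]|x t]; case: (D0 t).
- by case.
Qed.

(** If 0 = 1 in k(G/e), then also in k(X x G), and the norm along X x G -> X
    sends 0 to 0 and 1 to 1. *)
Lemma bottom_nonzero k : tam_nonzero k -> (1 : k gfree) <> 0.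
Proof.
case=> X nzX k0; apply: nzX.
have [nm1 _] := nm_monoid k (free_cover X).
rewrite -nm1 -[RHS](@nm_surj0 k _ _ (free_cover X)); last first.
  by move=> x; exists (x, 1%g); rewrite /= gset_act1.
congr (nm k _ _); apply: free_ext => i.
by rewrite -[LHS]mulr1 -[RHS]mulr1 k0 !mulr0.
Qed.

End FreeGSets.

Arguments free_incl {gT I} i.

(** * The adjunction with fixed-point functors *)

Section PointRestriction.
Variables (gT : finGroupType) (k : tambara gT).

Section Along.
Variables (X Y : gset gT) (f : gmap X Y) (y : Y).

Let A := [pred x | f x == y].
Let F := free_on gT {x | x \in A}.

Let toX : gmap F X :=
  @GMap gT F X (fun w : F => gset_act X (val w.1) w.2) (fun w a => gset_actM _ _ _).

Let toG : gmap F gfree := @GMap gT F gfree (fun w : F => w.2) (fun w a => erefl).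

(* The pullback of f along G -> Y, g |-> y * g, is free on the fibre of y:
   an element x over y * g is recorded as the pair (x * g^-1, g). *)
Let fibre_square : is_pullback toX toG f (point_map y).
Proof.
split=> [[[x Ax] g] | x g /= fx] /=.
  by rewrite gmap_eqv (eqP Ax).
have Ax : gset_act X x g^-1%g \in A by rewrite inE gmap_eqv fx gset_actK.
exists (exist (fun z => z \in A) _ Ax, g); split=> /= [|[[x' Ax'] g'] /= [xE gE]].
  by rewrite gset_actKV.
by congr (_, _) => //; apply/val_inj; rewrite /= -xE gE gset_actK.
Qed.

(** The transfer and the norm are computed pointwise, on the points of the
    fibres; this is what makes the unit compatible with them. *)
Lemma res_point_tr a :
  res k (point_map y) (tr k f a) = \sum_(x | f x == y) res k (point_map x) a.
Proof.
rewrite (tr_pullback fibre_square) tr_free (big_sub A (fun x => res k (point_map x) a)).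
apply: eq_bigr => i _; rewrite (@tr_ext _ _ _ _ _ (gid gfree)) // tr_id.
by have /= <- := res_comp (t := k) toX (free_incl i) a; apply: res_ext.
Qed.

Lemma res_point_nm a :
  res k (point_map y) (nm k f a) = \prod_(x | f x == y) res k (point_map x) a.
Proof.
rewrite (nm_pullback fibre_square) nm_free (big_sub A (fun x => res k (point_map x) a)).
apply: eq_bigr => i _; rewrite (@nm_ext _ _ _ _ _ (gid gfree)) // nm_id.
by have /= <- := res_comp (t := k) toX (free_incl i) a; apply: res_ext.
Qed.

End Along.

Lemma res_point_res (X Y : gset gT) (f : gmap X Y) (x : X) a :
  res k (point_map x) (res k f a) = res k (point_map (f x)) a.
Proof.
have /= <- := res_comp (t := k) f (point_map x) a.
by apply: res_ext => g /=; rewrite gmap_eqv.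
Qed.

Lemma res_point_act (X : gset gT) (x : X) g a :
  res k (point_map (gset_act X x g)) a =
  gring_act (bottom_gring k) (res k (point_map x) a) g.
Proof.
rewrite /= /bottom_act; have /= <- := res_comp (t := k) (point_map x) (lmul g) a.
by apply: res_ext => h /=; rewrite gset_actM.
Qed.

End PointRestriction.

Section Adjunct.
Variables (gT : finGroupType) (k : tambara gT) (S : gring [set: gT]).
Variable theta : {rmorphism bottom_gring k -> S}.
Hypothesis theta_act :
  forall x g, theta (gring_act (bottom_gring k) x g) = gring_act S (theta x) g.

Section Component.
Variable X : gset gT.

Fact adjunct_subproof (a : k X) :
  equivariant (gset_act X) [ffun x : X => theta (res k (point_map x) a)].
Proof.
by apply/equivariantP => x g _; rewrite !ffunE res_point_act theta_act.
Qed.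

Definition adjunct_val (a : k X) : fpt S X := EqvMap (adjunct_subproof a).

Fact adjunct_zmod : zmod_morphism adjunct_val.
Proof. by move=> a b; apply: fptP => x; rewrite /= !ffunE !rmorphB. Qed.

Fact adjunct_monoid : monoid_morphism adjunct_val.
Proof.
by split=> [|a b]; apply: fptP => x; rewrite /= !ffunE ?rmorph1 ?rmorphM.
Qed.

HB.instance Definition _ :=
  GRing.isZmodMorphism.Build (k X) (fpt S X) adjunct_val adjunct_zmod.
HB.instance Definition _ :=
  GRing.isMonoidMorphism.Build (k X) (fpt S X) adjunct_val adjunct_monoid.

Definition adjunct_rmorphism : {rmorphism k X -> fixed_point_tambara S X} :=
  adjunct_val : {rmorphism k X -> fpt S X}.

End Component.

(** The transpose of theta under the adjunction between evaluation at G/e and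
    the fixed-point functor. *)
Definition adjunct : tmor k (fixed_point_tambara S).
Proof.
exists adjunct_rmorphism => X Y f a; apply: fptP => y; rewrite /= !ffunE.
- by rewrite res_point_res.
- by rewrite res_point_tr rmorph_sum; apply: eq_bigr => x _; rewrite ffunE.
- by rewrite res_point_nm rmorph_prod; apply: eq_bigr => x _; rewrite ffunE.
Defined.

Lemma adjunctE X (a : k X) x :
  eqvmap_val (adjunct X a) x = theta (res k (point_map x) a).
Proof. by rewrite /= ffunE. Qed.

End Adjunct.

(** * Monic morphisms are injective *)

(** The levelwise kernel pair of a morphism is again a Tambara functor, so a
    monic morphism cannot identify two distinct elements at any level. *)
Section KernelPair.
Variables (gT : finGroupType) (k l : tambara gT) (phi : tmor k l).

Section Level.
Variable X : gset gT.

Definition same_image (u : k X * k X) := phi X u.1 == phi X u.2.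

Record kpair := KPair { kpair_val :> k X * k X; kpairP : same_image kpair_val }.

HB.instance Definition _ := [isSub for kpair_val].
HB.instance Definition _ := [Choice of kpair by <:].

Fact kpair_subring : subring_closed same_image.
Proof.
split=> [|u v /eqP hu /eqP hv|u v /eqP hu /eqP hv]; apply/eqP => //=.
  by rewrite !rmorphB hu hv.
by rewrite !rmorphM hu hv.
Qed.

HB.instance Definition _ :=
  GRing.SubChoice_isSubComPzRing.Build (k X * k X)%type same_image kpair
    kpair_subring.

Lemma kpair_eq (u v : kpair) : u.1 = v.1 -> u.2 = v.2 -> u = v.
Proof.
move=> h1 h2; apply/val_inj; rewrite /=.
by case: (kpair_val u) (kpair_val v) h1 h2 => ? ? [? ?] /= -> ->.
Qed.

Definition kp_fst (u : kpair) : k X := u.1.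
Definition kp_snd (u : kpair) : k X := u.2.

Fact kp_fst_zmod : zmod_morphism kp_fst. Proof. by []. Qed.
Fact kp_snd_zmod : zmod_morphism kp_snd. Proof. by []. Qed.
Fact kp_fst_monoid : monoid_morphism kp_fst. Proof. by []. Qed.
Fact kp_snd_monoid : monoid_morphism kp_snd. Proof. by []. Qed.

HB.instance Definition _ := GRing.isZmodMorphism.Build kpair (k X) kp_fst kp_fst_zmod.
HB.instance Definition _ := GRing.isZmodMorphism.Build kpair (k X) kp_snd kp_snd_zmod.
HB.instance Definition _ := GRing.isMonoidMorphism.Build kpair (k X) kp_fst kp_fst_monoid.
HB.instance Definition _ := GRing.isMonoidMorphism.Build kpair (k X) kp_snd kp_snd_monoid.

End Level.

Section Operations.
Variables (X Y : gset gT) (f : gmap X Y).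

Fact kp_res_subproof (u : kpair Y) : same_image (res k f u.1, res k f u.2).
Proof. by apply/eqP; rewrite /= !tmor_res (eqP (kpairP u)). Qed.
Definition kp_res (u : kpair Y) : kpair X := KPair (kp_res_subproof u).

Fact kp_tr_subproof (u : kpair X) : same_image (tr k f u.1, tr k f u.2).
Proof. by apply/eqP; rewrite /= !tmor_tr (eqP (kpairP u)). Qed.
Definition kp_tr (u : kpair X) : kpair Y := KPair (kp_tr_subproof u).

Fact kp_nm_subproof (u : kpair X) : same_image (nm k f u.1, nm k f u.2).
Proof. by apply/eqP; rewrite /= !tmor_nm (eqP (kpairP u)). Qed.
Definition kp_nm (u : kpair X) : kpair Y := KPair (kp_nm_subproof u).

Fact kp_res_zmod : zmod_morphism kp_res.
Proof. by move=> u v; apply: kpair_eq; rewrite /= raddfB. Qed.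

Fact kp_res_monoid : monoid_morphism kp_res.
Proof. by split=> [|u v]; apply: kpair_eq; rewrite /= ?rmorph1 ?rmorphM. Qed.

Fact kp_tr_zmod : zmod_morphism kp_tr.
Proof. by move=> u v; apply: kpair_eq; rewrite /= raddfB. Qed.

Fact kp_nm_monoid : monoid_morphism kp_nm.
Proof.
by have [nm1 nmM] := nm_monoid k f; split=> [|u v]; apply: kpair_eq => /=.
Qed.

HB.instance Definition _ :=
  GRing.isZmodMorphism.Build (kpair Y) (kpair X) kp_res kp_res_zmod.
HB.instance Definition _ :=
  GRing.isMonoidMorphism.Build (kpair Y) (kpair X) kp_res kp_res_monoid.
HB.instance Definition _ :=
  GRing.isZmodMorphism.Build (kpair X) (kpair Y) kp_tr kp_tr_zmod.

End Operations.

(* The glued pair has equal images because phi commutes with restriction and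
   l(X + Y) is detected on X and Y. *)
Fact kp_sum X Y :
  bijective (fun u : kpair (gsum X Y) =>
               (kp_res (ginl X Y) u, kp_res (ginr X Y) u)).
Proof.
have [h hK Kh] := tam_sum k X Y.
have KhE a b : res k (ginl X Y) (h (a, b)) = a /\ res k (ginr X Y) (h (a, b)) = b.
  by have [] := Kh (a, b).
have glueP (u : kpair X) (v : kpair Y) : same_image (h (u.1, v.1), h (u.2, v.2)).
  apply/eqP/(bij_inj (tam_sum l X Y)); rewrite /= -!tmor_res.
  by rewrite !(KhE _ _).1 !(KhE _ _).2 (eqP (kpairP u)) (eqP (kpairP v)).
exists (fun w => KPair (glueP w.1 w.2)) => [u|[u v]].
  by apply: kpair_eq; rewrite /= hK.
by congr (_, _); apply: kpair_eq; rewrite /= ?(KhE _ _).1 ?(KhE _ _).2.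
Qed.

Definition kernel_pair : tambara gT.
Proof.
apply: (@Tambara gT (fun X => kpair X : comPzRingType) kp_res kp_tr kp_nm
          kp_nm_monoid).
- by move=> X Y f g fg u; apply: kpair_eq; apply: res_ext.
- by move=> X Y f g fg u; apply: kpair_eq; apply: tr_ext.
- by move=> X Y f g fg u; apply: kpair_eq; apply: nm_ext.
- by move=> X u; apply: kpair_eq; apply: res_id.
- by move=> X u; apply: kpair_eq; apply: tr_id.
- by move=> X u; apply: kpair_eq; apply: nm_id.
- by move=> X Y Z g f u; apply: kpair_eq; apply: res_comp.
- by move=> X Y Z g f u; apply: kpair_eq; apply: tr_comp.
- by move=> X Y Z g f u; apply: kpair_eq; apply: nm_comp.
- by move=> u; apply: kpair_eq; apply: tam_empty.
- exact: kp_sum.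
- by move=> X Y Z P p q f g sq u; apply: kpair_eq; apply: tr_pullback.
- by move=> X Y Z P p q f g sq u; apply: kpair_eq; apply: nm_pullback.
- by move=> X Y A E f p e pX f' sq ev u; apply: kpair_eq; exact: (nm_tr sq ev).
Defined.

Definition kernel_pair_fst : tmor kernel_pair k :=
  @TMor gT kernel_pair k (fun X => @kp_fst X : {rmorphism kpair X -> k X})
    (fun _ _ _ _ => erefl) (fun _ _ _ _ => erefl) (fun _ _ _ _ => erefl).

Definition kernel_pair_snd : tmor kernel_pair k :=
  @TMor gT kernel_pair k (fun X => @kp_snd X : {rmorphism kpair X -> k X})
    (fun _ _ _ _ => erefl) (fun _ _ _ _ => erefl) (fun _ _ _ _ => erefl).

Lemma monic_injective : tam_monic phi -> forall X, injective (phi X).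
Proof.
move=> mono X a b ab.
have abP : same_image (a, b) by apply/eqP.
apply: (mono _ kernel_pair_fst kernel_pair_snd _ X (KPair abP)) => Y u.
exact/eqP/kpairP.
Qed.

End KernelPair.

(** A morphism out of a field-like functor is injective as soon as its target
    is nonzero, and the fixed-point functor of a nonzero ring is nonzero. *)
Section FieldLikeInjective.
Variables (gT : finGroupType) (k : tambara gT) (S : gring [set: gT]).
Variable theta : {rmorphism bottom_gring k -> S}.
Hypothesis theta_act :
  forall x g, theta (gring_act (bottom_gring k) x g) = gring_act S (theta x) g.
Hypotheses (kF : field_like k) (S_nz : (1 : S) <> 0).

Lemma adjunct_injective X : injective (adjunct theta_act X).
Proof.
case: kF => _ mono; apply/monic_injective/mono; exists gfree => /= e; apply: S_nz.
have := congr1 (fun u : fpt S gfree => eqvmap_val u (1%g : gT)) e.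
by rewrite /= !ffunE.
Qed.

Lemma field_like_injective : injective theta.
Proof.
apply: raddf_inj => a a0; apply: (@adjunct_injective gfree); apply: fptP => g.
rewrite !adjunctE rmorph0 rmorph0.
rewrite (_ : res k (point_map _) a = gring_act (bottom_gring k) a g).
  by rewrite theta_act a0 gact0 // inE.
exact: res_ext.
Qed.

End FieldLikeInjective.

(** * Quotients of rings with group action *)

Lemma inj_surj_bij (T : choiceType) (U : eqType) (f : T -> U) :
  injective f -> (forall y, exists x, f x = y) -> bijective f.
Proof.
move=> finj fsurj.
have ex y : exists x, f x == y by have [x <-] := fsurj y; exists x.
exists (fun y => xchoose (ex y)) => [x|y]; last exact/eqP/(xchooseP (ex y)).
by apply/finj/eqP/(xchooseP (ex (f x))).
Qed.

Section GRingActions.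
Variables (gT : finGroupType) (R : gring [set: gT]).
Implicit Types (x : R) (g h : gT).

Lemma ractM x g h : gring_act R x (g * h)%g = gring_act R (gring_act R x g) h.
Proof.
by case: (gring_act R) => to [toI toM] /=; apply: toM; rewrite inE.
Qed.

Lemma ract1 x : gring_act R x 1%g = x.
Proof.
have injR : left_injective (gring_act R) by case: (gring_act R) => to [].
by apply: (injR 1%g); rewrite -ractM mulg1.
Qed.

Lemma ractK g : cancel (gring_act R ^~ g) (gring_act R ^~ g^-1%g).
Proof. by move=> x; rewrite -ractM mulgV ract1. Qed.

Lemma ractKV g : cancel (gring_act R ^~ g^-1%g) (gring_act R ^~ g).
Proof. by move=> x; rewrite -ractM mulVg ract1. Qed.

Lemma ract_mul x (y : R) g : gring_act R (x * y) g = gring_act R x g * gring_act R y g.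
Proof. by rewrite gactM ?inE. Qed.

End GRingActions.

Definition invariant_ideal (gT : finGroupType) (R : gring [set: gT])
    (H : {set gT}) (I : {pred R}) :=
  [/\ zmod_closed I, forall a x, x \in I -> a * x \in I
    & forall x g, g \in H -> x \in I -> gring_act R x g \in I].

Section QuotientGRing.
Variables (gT : finGroupType) (R : gring [set: gT]) (H : {group gT}).
Variable (I : {pred R}).
Hypothesis I_inv : invariant_ideal H I.

Let Izmod : zmod_closed I. Proof. by case: I_inv. Qed.
Let IM a x : x \in I -> a * x \in I. Proof. by case: I_inv => _ h _; apply: h. Qed.
Let Iact x g : g \in H -> x \in I -> gring_act R x g \in I.
Proof. by case: I_inv => _ _ h; apply: h. Qed.

Let J : zmodClosed R := HB.pack_for (zmodClosed R) I (GRing.isZmodClosed.Build R I Izmod).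

Definition quotient_by := Quotient.quot J.
HB.instance Definition _ := GRing.Zmodule.on quotient_by.

Definition qproj (x : R) : quotient_by := \pi_(Quotient.quot J)%qT x.
Definition qrepr (q : quotient_by) : R := generic_quotient.repr (q : Quotient.quot J).

Lemma qreprK q : qproj (qrepr q) = q. Proof. exact: reprK. Qed.

Lemma qprojP x y : reflect (qproj x = qproj y) (x - y \in I).
Proof. by have /= -> := Quotient.idealrBE J x y; apply: eqP. Qed.

Lemma qproj_zmod : zmod_morphism qproj.
Proof. by move=> x y; rewrite /qproj raddfB. Qed.

HB.instance Definition _ := GRing.isZmodMorphism.Build R quotient_by qproj qproj_zmod.

Definition qmul (q r : quotient_by) : quotient_by := qproj (qrepr q * qrepr r).

Lemma qmulE x y : qmul (qproj x) (qproj y) = qproj (x * y).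
Proof.
apply/qprojP; set x' := qrepr _; set y' := qrepr _.
have xx' : x' - x \in I by apply/qprojP; rewrite qreprK.
have yy' : y' - y \in I by apply/qprojP; rewrite qreprK.
have -> : x' * y' - x * y = x' * (y' - y) + y * (x' - x).
  by rewrite !mulrBr [y * x']mulrC [y * x]mulrC addrA subrK.
have [I0 IB] := Izmod.
by rewrite -[y * _]opprK IB ?IM // -sub0r IB ?IM.
Qed.

Fact qmulA : associative qmul.
Proof.
by move=> q r s; rewrite -[q]qreprK -[r]qreprK -[s]qreprK !qmulE mulrA.
Qed.
Fact qmulC : commutative qmul.
Proof. by move=> q r; rewrite -[q]qreprK -[r]qreprK !qmulE mulrC. Qed.
Fact qmul1 : left_id (qproj 1) qmul.
Proof. by move=> q; rewrite -[q]qreprK !qmulE mul1r. Qed.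
Fact qmulDl : left_distributive qmul +%R.
Proof.
move=> q r s; rewrite -[q]qreprK -[r]qreprK -[s]qreprK.
by rewrite -raddfD !qmulE mulrDl raddfD.
Qed.

HB.instance Definition _ :=
  GRing.Zmodule_isComPzRing.Build quotient_by qmulA qmulC qmul1 qmulDl.

Fact qproj_monoid : monoid_morphism qproj.
Proof. by split=> [|x y]; [exact: erefl | exact/esym/qmulE]. Qed.

HB.instance Definition _ :=
  GRing.isMonoidMorphism.Build R quotient_by qproj qproj_monoid.

(** Outside H the ideal need not be stable; the action is then the identity, as
    an action with domain H must still be injective there. *)
Definition qact (q : quotient_by) (a : gT) : quotient_by :=
  if a \in H then qproj (gring_act R (qrepr q) a) else q.

Lemma qactE x a : a \in H -> qact (qproj x) a = qproj (gring_act R x a).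
Proof.
move=> Ha; rewrite /qact Ha; apply/qprojP; rewrite -gactB ?inE //.
by apply: Iact => //; apply/qprojP; rewrite qreprK.
Qed.

Fact qact_is_action : is_action H qact.
Proof.
split=> [a q r|q a b Ha Hb].
  have [Ha|Ha] := boolP (a \in H); last by rewrite /qact (negPf Ha).
  rewrite -[q]qreprK -[r]qreprK !qactE // => /qprojP; rewrite -gactB ?inE // => qr.
  apply/qprojP; rewrite -[X in X \in I](ractK a); apply: Iact => //.
  by rewrite groupV.
by rewrite -[q]qreprK !qactE ?groupM // ractM.
Qed.

Definition qaction := Action qact_is_action.

Fact qaction_zmod a : a \in H -> zmod_morphism (qaction^~ a).
Proof.
move=> Ha q r; rewrite -[q]qreprK -[r]qreprK -raddfB /= !qactE //.
by rewrite gactB ?inE // raddfB.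
Qed.

Fact qaction_monoid a : a \in H -> monoid_morphism (qaction^~ a).
Proof.
move=> Ha; split=> [|q r]; first by rewrite -[1]/(qproj 1) /= qactE ?gact1 ?inE.
by rewrite -[q]qreprK -[r]qreprK -rmorphM /= !qactE // ract_mul rmorphM.
Qed.

Definition quotient_gring : gring H := GRingAct qaction_zmod qaction_monoid.

End QuotientGRing.

(** * Rings without proper invariant ideals *)

Section Simple.
Variables (gT : finGroupType) (R : gring [set: gT]).

Definition gsimple :=
  (1 : R) <> 0 /\
  forall I : {pred R}, invariant_ideal [set: gT] I -> 1 \notin I ->
  forall x, x \in I -> x = 0.

Hypothesis Rsimple : gsimple.

Lemma simple_ideal (I : {pred R}) x :
  invariant_ideal [set: gT] I -> x \in I -> x != 0 -> 1 \in I.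
Proof.
move=> inv xI; apply: contraR => I1; apply/eqP.
by have [_ h] := Rsimple; apply: (h I).
Qed.

(** The combinations of the conjugates of y form an invariant ideal. *)
Lemma orbit_generates (y : R) :
  y != 0 -> exists c : gT -> R, 1 = \sum_g c g * gring_act R y g.
Proof.
pose I := [pred z : R | `[< exists c : gT -> R, z = \sum_g c g * gring_act R y g >]].
move=> y0; suff: 1 \in I by move=> /asboolP.
apply: (@simple_ideal _ y) => //; last first.
  apply/asboolP; exists (fun g => (g == 1%g)%:R).
  by rewrite (bigD1 1%g) //= ract1 eqxx mul1r big1 ?addr0 // => g /negPf ->; rewrite mul0r.
split; first split.
- apply/asboolP; exists (fun=> 0); by rewrite big1 // => g _; rewrite mul0r.
- move=> _ _ /asboolP[c ->] /asboolP[d ->]; apply/asboolP; exists (fun g => c g - d g).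
  by rewrite -sumrB; apply: eq_bigr => g _; rewrite mulrBl.
- move=> a _ /asboolP[c ->]; apply/asboolP; exists (fun g => a * c g).
  by rewrite mulr_sumr; apply: eq_bigr => g _; rewrite mulrA.
move=> _ h _ /asboolP[c ->]; apply/asboolP.
exists (fun g => gring_act R (c (g * h^-1)%g) h).
rewrite gact_sum ?inE // (reindex_inj (mulIg h^-1%g)) /=.
by apply: eq_bigr => g _; rewrite ract_mul -!ractM mulgKV.
Qed.

Lemma fixed_unit (y : R) :
  y != 0 -> (forall g, gring_act R y g = y) -> exists z, y * z = 1.
Proof.
move=> /orbit_generates[c ->] yfix; exists (\sum_g c g).
by rewrite mulr_sumr; apply: eq_bigr => g _; rewrite yfix mulrC.
Qed.

Section Nonunit.
Variable x : R.
Hypotheses (x0 : x != 0) (xNU : forall z, x * z <> 1).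

Let e (S : {set gT}) := \prod_(s in S) gring_act R x s.

Let e_act S g : gring_act R (e S) g = e (S :* g)%g.
Proof.
rewrite /e gact_prod ?inE // (reindex_inj (mulIg g^-1%g)) /=.
apply: eq_big => [s|s _]; first by rewrite mem_rcoset.
by rewrite -ractM mulgKV.
Qed.

(* This product is invariant, and it is a multiple of the nonunit x. *)
Let e_setT : e [set: gT] = 0.
Proof.
apply/eqP; apply: contraT => N0.
have [|z] := fixed_unit N0.
  by move=> g; rewrite e_act; congr e; apply/setP => s; rewrite mem_rcoset !inE.
by rewrite /e (bigD1 1%g) ?inE //= ract1 -mulrA => /xNU.
Qed.

(** Let S be a largest set of group elements for which the product y of the x^s
    is nonzero.  If g does not stabilise S then S and its translate by g have a
    strictly larger union, so y y^g = 0; otherwise y^g = y.  Writing 1 as a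
    combination of the conjugates of y and multiplying by y gives y = y^2 b, so
    y b is idempotent.  The stabiliser of S is proper: if it were the whole group,
    S would be too, but the product of all conjugates of x vanishes. *)
Lemma simple_idempotent :
  exists (H : {group gT}) (f : R),
    [/\ H \proper [set: gT], f != 0, f * f = f,
        forall g, g \in H -> gring_act R f g = f
      & forall g, g \notin H -> f * gring_act R f g = 0].
Proof.
have e1 : e [set 1%g] != 0 by rewrite /e big_set1 ract1.
have [S S0 Smax] := @arg_maxnP _ [set 1%g] (fun S : {set gT} => e S != 0) (fun S => #|S|) e1.
pose y := e S; pose D := [set g | (S :* g)%g == S].
have Dgroup : group_set D.
  apply/group_setP; split=> [|g h]; rewrite !inE; first by rewrite mulg1.
  by rewrite rcosetM => /eqP-> /eqP->.
have yD g : g \in D -> gring_act R y g = y by rewrite inE e_act => /eqP->.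
have yND g : g \notin D -> y * gring_act R y g = 0.
  rewrite inE e_act => Dg; rewrite /y /e [X in _ * X = _](big_setID S) /=.
  suff e0 : e (S :|: (S :* g)%g) = 0.
    rewrite mulrCA -[RHS](mulr0 (\prod_(s in (S :* g)%g :&: S) gring_act R x s)).
    rewrite -e0 /e; congr (_ * _); rewrite [RHS](big_setID S) /=.
    by congr (_ * _); apply: eq_bigl => s; rewrite !inE; case: (s \in S); rewrite ?andbF.
  apply/eqP; apply: contraNT Dg => /Smax /=.
  rewrite (geq_leqif (subset_leqif_card (subsetUl _ _))) subUset subxx /=.
  by rewrite eqEcard card_rcoset leqnn andbT.
have [c c1] := @orbit_generates y S0.
pose b := \sum_(g in D) c g.
have yyb : y * y * b = y.
  rewrite -[RHS]mulr1 c1 !mulr_sumr [RHS](bigID (mem D)) /=.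
  rewrite [X in _ = _ + X]big1 ?addr0 => [|g Dg]; last by rewrite mulrCA yND ?mulr0.
  by apply: eq_bigr => g Dg; rewrite yD // mulrAC mulrA mulrAC.
have fy : y * b * y = y by rewrite mulrAC.
exists (Group Dgroup), (y * b); split.
- rewrite properT; apply: contraNneq S0 => /= DT.
  suff -> : S = [set: gT] by rewrite e_setT.
  have [s Ss] : exists s, s \in S.
    by apply/set0Pn; rewrite -card_gt0; apply: leq_trans (Smax _ e1); rewrite cards1.
  apply/setP => t; rewrite inE; have : (s^-1 * t)%g \in D by rewrite DT inE.
  by rewrite inE => /eqP <-; rewrite mem_rcoset invMg invgK mulKVg.
- by apply: contraNneq S0 => f0; rewrite -/y -fy f0 mul0r.
- by rewrite mulrA fy.
- move=> g Dg; have f'y : gring_act R (y * b) g * y = y.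
    transitivity (gring_act R (y * b * y) g); last by rewrite fy yD.
    by rewrite [RHS]ract_mul yD.
  transitivity (y * b * gring_act R (y * b) g).
    by rewrite ract_mul (yD g Dg) mulrA fy.
  by rewrite mulrC mulrA f'y.
- by move=> g Dg; rewrite ract_mul mulrACA yND ?mul0r.
Qed.

End Nonunit.

(** An idempotent f whose conjugates are f, over H, or orthogonal to f, outside
    H, cuts out the factor R/Ann(f) = fR on which H acts.  The map from R to the
    ring coinduced from it has as kernel an invariant ideal without 1; its
    surjectivity is seen by adding up, over the cosets of H, the conjugates of
    lifts to fR of prescribed values. *)
Section Coinduced.
Variables (H : {group gT}) (f : R).
Hypotheses (f0 : f != 0) (ff : f * f = f).
Hypothesis fH : forall g, g \in H -> gring_act R f g = f.
Hypothesis fNH : forall g, g \notin H -> f * gring_act R f g = 0.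

Let Ann := [pred x : R | f * x == 0].

Let Ann_inv : invariant_ideal H Ann.
Proof.
split; [split|..] => [|x y|a x|x g Hg]; rewrite !inE ?mulr0 //.
- by move=> /eqP fx /eqP fy; rewrite mulrBr fx fy subr0.
- by move=> /eqP fx; rewrite mulrCA fx mulr0.
- by move=> /eqP fx; rewrite -[X in X * _](fH Hg) -ract_mul fx gact0 ?inE.
Qed.

Let Q := quotient_gring Ann_inv.
Let proj : R -> Q := qproj Ann_inv.
Let lift : Q -> R := @qrepr _ _ _ _ Ann_inv.

Let projP x y : reflect (proj x = proj y) (f * x == f * y).
Proof. by rewrite -subr_eq0 -mulrBr; apply: (qprojP Ann_inv). Qed.

Let proj_act x g : g \in H -> proj (gring_act R x g) = gring_act Q (proj x) g.
Proof. by move=> Hg; rewrite -[RHS]/(qact _ _) qactE. Qed.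

Fact to_coind_subproof (x : R) :
  equivariant (fun z a : gT => (z * a)%g) [ffun z : gT => proj (gring_act R x z)].
Proof. by apply/equivariantP => z a Ha; rewrite !ffunE ractM proj_act. Qed.

Definition to_coind (x : R) : coind Q := EqvMap (to_coind_subproof x).

Fact to_coind_zmod : zmod_morphism to_coind.
Proof.
move=> x y; apply/val_inj/ffunP => z; rewrite /= !ffunE gactB ?inE //.
exact: (raddfB (qproj Ann_inv)).
Qed.

Fact to_coind_monoid : monoid_morphism to_coind.
Proof.
split=> [|x y]; apply/val_inj/ffunP => z; rewrite /= !ffunE.
  by rewrite gact1 ?inE //; apply: (rmorph1 (qproj Ann_inv)).
by rewrite ract_mul; apply: (rmorphM (qproj Ann_inv)).
Qed.

HB.instance Definition _ :=
  GRing.isZmodMorphism.Build R (coind Q) to_coind to_coind_zmod.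
HB.instance Definition _ :=
  GRing.isMonoidMorphism.Build R (coind Q) to_coind to_coind_monoid.

Let to_coind_inj : injective to_coind.
Proof.
apply: raddf_inj => x x0.
pose I := [pred r : R | [forall z, f * gring_act R r z == 0]].
have I_inv : invariant_ideal [set: gT] I.
  split; [split|..] => [|u v /forallP hu /forallP hv|a u /forallP hu|u g _ /forallP hu].
  - by apply/forallP => z; rewrite gact0 ?inE // mulr0.
  - by apply/forallP => z; rewrite gactB ?inE // mulrBr (eqP (hu z)) (eqP (hv z)) subr0.
  - by apply/forallP => z; rewrite ract_mul mulrCA (eqP (hu z)) mulr0.
  - by apply/forallP => z; rewrite -ractM.
have [_ h] := Rsimple; apply: (h I I_inv).
  by apply/forallPn; exists 1%g; rewrite ract1 mulr1.
apply/forallP => z; have /ffunP/(_ z) := congr1 val x0; rewrite /= !ffunE => e.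
by rewrite -[X in _ == X](mulr0 f); apply/projP; rewrite e; apply/esym/(raddf0 (qproj Ann_inv)).
Qed.

Let to_coind_surj (u : coind Q) : exists x, to_coind x = u.
Proof.
pose v : gT -> Q := eqvmap_val u.
have vE z a : a \in H -> v (z * a)%g = gring_act Q (v z) a.
  by move=> Ha; have /equivariantP := eqvmapP u; apply.
(* The element of R supported on the conjugate of f by z^-1 with value v z
   there; it depends on the coset z H alone. *)
pose s z := gring_act R (f * lift (v z)) z^-1%g.
have s_coset z h : h \in H -> s (z * h)%g = s z.
  move=> Hh; rewrite /s invMg ractM; congr (gring_act R _ _).
  apply: (can_inj (ractK (R := R) h)); rewrite ractKV ract_mul fH //.
  apply/eqP/projP; rewrite proj_act //.
  by rewrite /proj /lift !qreprK vE.
have s_off z w : (z^-1 * w)%g \notin H -> f * gring_act R (s z) w = 0.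
  by move=> zw; rewrite /s -ractM ract_mul mulrA fNH // mul0r.
exists (\sum_(B in lcosets H [set: gT]) s (repr B)).
apply/val_inj/ffunP => z; rewrite /= ffunE -[RHS]/(v z).
have -> : v z = proj (lift (v z)) by rewrite /proj /lift qreprK.
apply/projP/eqP; rewrite gact_sum ?inE // mulr_sumr.
rewrite (bigD1 (z *: H)%g) /=; last by apply/lcosetsP; exists z; rewrite ?inE.
rewrite big1 ?addr0; last first.
  move=> _ /andP[/lcosetsP[w _ ->] wz]; apply: s_off; apply: contra wz.
  have /lcosetP[h Hh ->] := mem_repr _ (lcoset_refl H w).
  rewrite invMg -mulgA groupMl ?groupV // => wz; apply/eqP/lcoset_eqP.
  by rewrite mem_lcoset -groupV invMg invgK.
have /lcosetP[h Hh ->] := mem_repr _ (lcoset_refl H z).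
by rewrite s_coset // /s ractKV mulrA ff.
Qed.

Lemma coinduced_from_idempotent : exists Q' : gring H, gring_isomorphic R (coind Q').
Proof.
exists Q, (to_coind : {rmorphism R -> coind Q}); split.
  exact: inj_surj_bij to_coind_inj to_coind_surj.
move=> x a _; apply/val_inj/ffunP => z; by rewrite /= !ffunE ractM.
Qed.

End Coinduced.

Lemma simple_field :
  (forall (H : {group gT}) (Q : gring H),
     H \proper [set: gT] -> ~ gring_isomorphic R (coind Q)) ->
  is_field R.
Proof.
move=> nocoind; split=> [|x /eqP x0]; first by case: Rsimple.
apply: contrapT => xNU; have [|H [f [Hprop f0 ff fH fNH]]] := simple_idempotent x0.
  by move=> z xz; apply: xNU; exists z.
have [Q isoQ] := coinduced_from_idempotent f0 ff fH fNH.
exact: nocoind isoQ.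
Qed.

End Simple.

(** If I is a proper invariant ideal, k maps to the fixed-point functor of the
    nonzero ring R/I, and at G/e this map is the projection R -> R/I; being
    injective, it forces I = 0. *)
Lemma field_like_simple (gT : finGroupType) (k : tambara gT) :
  field_like k -> gsimple (bottom_gring k).
Proof.
move=> kF; split; first by apply: bottom_nonzero; case: kF.
move=> I I_inv I1 x xI.
have inv : invariant_ideal [set: gT]%G I by [].
have theta_act y g : qproj inv (gring_act (bottom_gring k) y g) =
    gring_act (quotient_gring inv) (qproj inv y) g.
  by rewrite -[RHS]/(qact _ _) qactE ?inE.
have Q1 : (1 : quotient_gring inv) <> 0.
  rewrite -[1]/(qproj inv 1) -(raddf0 (qproj inv)) => /qprojP.
  by rewrite subr0 (negPf I1).
apply: (@field_like_injective _ k (quotient_gring inv) (qproj inv) theta_act kF Q1).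
by apply/qprojP; rewrite subr0.
Qed.

Lemma clarified_field (gT : finGroupType) (k : tambara gT) :
  field_like k -> clarified k -> is_field (bottom_gring k).
Proof.
move=> kF kC; apply: simple_field (field_like_simple kF) _ => H Q Hprop isoQ.
by apply: kC; exists H, Q.
Qed.

(** * Fields with a perfect fixed field *)

Section PerfectExtension.
Variables (gT : finGroupType) (F : fieldType) (p : nat) (s : gT -> F -> F).
Hypothesis charFp : p \in [pchar F].
Hypotheses (sB : forall g, zmod_morphism (s g)) (sM : forall g, monoid_morphism (s g)).
Hypotheses (s1 : s 1%g =1 id) (sG : forall g h x, s (g * h)%g x = s h (s g x)).

HB.instance Definition _ g := GRing.isZmodMorphism.Build F F (s g) (sB g).
HB.instance Definition _ g := GRing.isMonoidMorphism.Build F F (s g) (sM g).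

(** Frobenius is injective, so there is a Lagrange interpolation polynomial P
    with P(z^p) = z on the finite orbit O of x.  It is invariant, so its
    coefficients are p-th powers d_i^p of elements d_i, and then
    x = P(x^p) = sum d_i^p x^(i p) is the p-th power of sum d_i x^i. *)
Lemma perfect_over_fixed :
  (forall c : F, (forall g, s g c = c) -> exists d : F, d ^+ p = c) ->
  forall x : F, exists y : F, y ^+ p = x.
Proof.
move=> rootK x.
pose O := undup [seq s g x | g : gT].
have O_uniq : uniq O by apply: undup_uniq.
have O_x : x \in O by rewrite mem_undup; apply/imageP; exists 1%g; rewrite ?s1.
have O_act g : perm_eq [seq s g z | z <- O] O.
  have gO_uniq : uniq [seq s g z | z <- O] by rewrite map_inj_uniq //; apply: fmorph_inj.
  have gO_sub : {subset [seq s g z | z <- O] <= O}.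
    move=> _ /mapP[z + ->]; rewrite !mem_undup => /imageP[h _ ->].
    by apply/imageP; exists (h * g)%g; rewrite ?sG.
  have [|_ gO_eq] := uniq_min_size gO_uniq gO_sub; first by rewrite size_map.
  exact: uniq_perm.
have frob_inj (z w : F) : z ^+ p = w ^+ p -> z = w.
  by rewrite -!(pFrobenius_autE charFp) => /fmorph_inj.
pose L z := \prod_(w <- O | w != z) ((z ^+ p - w ^+ p)^-1 *: ('X - (w ^+ p)%:P)).
pose P := \sum_(z <- O) z *: L z.
have P_fixed g : map_poly (s g) P = P.
  rewrite /P -[RHS](perm_big _ (O_act g)) big_map rmorph_sum /=.
  apply: eq_bigr => z _; rewrite map_polyZ; congr (_ *: _).
  rewrite /L -[RHS](perm_big _ (O_act g)) big_map rmorph_prod /=.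
  apply: eq_big => [w|w _]; first by rewrite (inj_eq (fmorph_inj _)).
  by rewrite map_polyZ rmorphB /= map_polyX map_polyC /= fmorphV rmorphB !rmorphXn.
have P_interp : P.[x ^+ p] = x.
  rewrite /P horner_sum (bigD1_seq x) //= big1 ?addr0 => [|z zx]; rewrite hornerZ.
    rewrite /L horner_prod big1_seq ?mulr1 // => w /andP[wx _].
    rewrite hornerZ hornerXsubC mulVf // subr_eq0.
    by apply: contra wx => /eqP/frob_inj ->.
  apply/eqP; rewrite mulf_eq0 /L horner_prod prodf_seq_eq0; apply/orP; right.
  apply/hasP; exists x => //=.
  by rewrite eq_sym zx hornerZ hornerXsubC subrr mulr0 eqxx.
have rootP i : exists d, d ^+ p == P`_i.
  have [|d dE] := rootK P`_i; last by exists d; apply/eqP.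
  by move=> g; rewrite -[in RHS](P_fixed g) coef_map.
exists (\sum_(i < size P) xchoose (rootP i) * x ^+ i).
rewrite -(pFrobenius_autE charFp) rmorph_sum -[RHS]P_interp horner_coef.
apply: eq_bigr => i _; rewrite /= pFrobenius_autE exprMn (eqP (xchooseP (rootP i))).
by rewrite -!exprM mulnC.
Qed.

End PerfectExtension.

(** A copy of R carrying the field structure that the proposition [is_field R]
    provides, so that polynomials over R are available. *)
Section FieldOf.
Variables (R : comPzRingType) (R_field : is_field R).

Definition field_of (_ : is_field R) : Type := R.
Local Notation F := (field_of R_field).

HB.instance Definition _ := GRing.ComPzRing.on F.

Fact field_of_oner_neq0 : (1 : F) != 0.
Proof. by apply/eqP; case: R_field. Qed.

HB.instance Definition _ := GRing.PzSemiRing_isNonZero.Build F field_of_oner_neq0.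

Fact field_of_ex (x : F) : exists y : F, (x != 0) ==> (y * x == 1).
Proof.
have [->|/eqP x0] /= := eqVneq x 0; first by exists 0.
have [_ h] := R_field; have [y xy] := h x x0.
by exists y; rewrite mulrC; apply/eqP.
Qed.

Definition field_of_inv (x : F) : F :=
  if x == 0 then 0 else xchoose (field_of_ex x).

Fact field_of_mulVf (x : F) : x != 0 -> field_of_inv x * x = 1.
Proof.
move=> x0; rewrite /field_of_inv ifN //; apply/eqP.
exact: (implyP (xchooseP (field_of_ex x))).
Qed.

Fact field_of_inv0 : field_of_inv 0 = 0.
Proof. by rewrite /field_of_inv ifT. Qed.

HB.instance Definition _ := GRing.ComNzRing_isField.Build F field_of_mulVf field_of_inv0.

End FieldOf.

Section PowersInField.
Variables (gT : finGroupType) (R : gring [set: gT]) (p : nat).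
Hypotheses (R_field : is_field R) (charRp : has_pchar R p).

Let F : fieldType := field_of R_field.

Let charFp : p \in [pchar F].
Proof. by case: charRp => pp p0; rewrite inE pp /=; apply/eqP. Qed.

Lemma power_injective n : injective (fun x : R => x ^+ (p ^ n)).
Proof.
elim: n => [|n IHn] x y //=.
rewrite expnS !exprM => /IHn xy.
exact: (fmorph_inj (pFrobenius_aut charFp)) xy.
Qed.

Lemma power_surjective n :
  perfect_field (fixed_ring R [set: gT]) -> forall x : R, exists y, y ^+ (p ^ n) = x.
Proof.
move=> [_ perf]; have root1 : forall x : F, exists y : F, y ^+ p = x.
  apply: (@perfect_over_fixed gT F p (fun g x => gring_act R x g) charFp).
  - by move=> g; apply: gring_actB; rewrite inE.
  - by move=> g; apply: gring_actM; rewrite inE.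
  - exact: ract1.
  - by move=> g h x; apply: ractM.
  move=> c cfix; have cP : is_fixed [set: gT] (c : R) by apply/forall_inP => g _; apply/eqP.
  have K_p : has_pchar (fixed_ring R [set: gT]) p.
    case: charRp => pp p0; split=> //; apply/val_inj.
    by rewrite /= -[RHS]p0 [LHS](rmorph_nat (val : fixed_ring R [set: gT] -> R)).
  have [d dE] := perf p K_p (FixedElt cP).
  by exists (val d); rewrite -[RHS]/(val (FixedElt cP)) -dE rmorphXn.
elim: n => [|n IHn] x; first by exists x.
have [z <-] := root1 x; have [y <-] := IHn z.
by exists y; rewrite expnSr exprM.
Qed.

End PowersInField.

(** * The unit of the adjunction is an isomorphism *)

Section IsoOfBijective.
Variables (gT : finGroupType) (k l : tambara gT) (phi : tmor k l).
Hypothesis phi_inj : forall X, injective (phi X).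
Hypothesis phi_surj : forall X (b : l X), exists a, phi X a = b.

Section Level.
Variable X : gset gT.

Fact tmor_inv_ex (b : l X) : exists a, phi X a == b.
Proof. by have [a <-] := phi_surj b; exists a. Qed.

Definition tmor_inv (b : l X) : k X := xchoose (tmor_inv_ex b).

Lemma tmor_invK : cancel tmor_inv (phi X).
Proof. by move=> b; apply/eqP/(xchooseP (tmor_inv_ex b)). Qed.

Lemma tmor_Kinv : cancel (phi X) tmor_inv.
Proof. by move=> a; apply/phi_inj/tmor_invK. Qed.

HB.instance Definition _ := GRing.isZmodMorphism.Build (l X) (k X) tmor_inv
  (can2_zmod_morphism tmor_Kinv tmor_invK).
HB.instance Definition _ := GRing.isMonoidMorphism.Build (l X) (k X) tmor_inv
  (can2_monoid_morphism tmor_Kinv tmor_invK).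

End Level.

Lemma tam_iso_of_bijective : tam_iso phi.
Proof.
have inv_res X Y (f : gmap X Y) b : tmor_inv (res l f b) = res k f (tmor_inv b).
  by apply: phi_inj; rewrite tmor_res !tmor_invK.
have inv_tr X Y (f : gmap X Y) b : tmor_inv (tr l f b) = tr k f (tmor_inv b).
  by apply: phi_inj; rewrite tmor_tr !tmor_invK.
have inv_nm X Y (f : gmap X Y) b : tmor_inv (nm l f b) = nm k f (tmor_inv b).
  by apply: phi_inj; rewrite tmor_nm !tmor_invK.
exists (@TMor gT l k (fun X => @tmor_inv X : {rmorphism l X -> k X})
          inv_res inv_tr inv_nm).
by move=> X; split; [exact: tmor_Kinv | exact: tmor_invK].
Qed.

End IsoOfBijective.

Section Unit.
Variables (gT : finGroupType) (k : tambara gT).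
Local Notation R := (bottom_gring k).

Definition tam_unit : tmor k (fixed_point_tambara R) :=
  @adjunct gT k R idfun (fun _ _ => erefl).

Lemma tam_unitE X (a : k X) x :
  eqvmap_val (tam_unit X a) x = res k (point_map x) a.
Proof. exact: adjunctE. Qed.

(** An equivariant map on I x G is determined by arbitrary values at the points
    (i, 1), and k(I x G) is the corresponding power of k(G/e). *)
Lemma tam_unit_free_surj (I : finType) (v : fpt R (free_on gT I)) :
  exists a, tam_unit (free_on gT I) a = v.
Proof.
have [a aE] := free_glue (fun i => eqvmap_val v (i, 1%g)).
exists a; apply: fptP => -[i g]; rewrite tam_unitE.
have -> : (i, g) = gset_act (free_on gT I) (i, 1%g) g by rewrite /= /free_act mul1g.
rewrite res_point_act fptE; congr (gring_act R _ g); rewrite -aE.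
by apply: res_ext => h; rewrite /= /free_act mul1g.
Qed.

(** The fibre of the action map over x consists of the pairs (x * g^-1, g). *)
Lemma card_free_cover_fibre (X : gset gT) (x : X) :
  #|[set z | free_cover X z == x]| = #|[set: gT]|.
Proof.
have -> : [set z | free_cover X z == x] =
    [set (gset_act X x g^-1%g, g) | g in [set: gT]].
  apply/setP => -[y g]; rewrite inE /=; apply/eqP/imsetP => [<-|[h _ [-> ->]]].
    by exists g; rewrite ?inE // gset_actK.
  by rewrite gset_actKV.
by rewrite card_imset // => g h [_ ->].
Qed.

Section Surjective.
Variable X : gset gT.

(** The inverse of an equivariant bijection is equivariant, so w = f^-1 u is an
    equivariant map. *)
Lemma fpt_lift (f : R -> R) (u : fpt R X) :
  injective f -> (forall y, exists x, f x = y) ->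
  (forall x g, f (gring_act R x g) = gring_act R (f x) g) ->
  exists w : fpt R X, forall x, f (eqvmap_val w x) = eqvmap_val u x.
Proof.
move=> finj fsurj fact.
have ex x : exists r, f r == eqvmap_val u x.
  by have [r <-] := fsurj (eqvmap_val u x); exists r.
have wE x := eqP (xchooseP (ex x)).
have wP : equivariant (gset_act X) [ffun x => xchoose (ex x)].
  apply/equivariantP => x g _; rewrite !ffunE.
  by apply: finj; rewrite fact !wE fptE.
by exists (EqvMap wP) => x; rewrite /= ffunE.
Qed.

(** With N = |G|, the map u is N w for some w, and N w is the transfer of the
    restriction of w along the action map, which comes from k. *)
Lemma tam_unit_surj_tr (u : fpt R X) :
  (exists c : R, #|[set: gT]|%:R * c = 1) -> exists a, tam_unit X a = u.
Proof.
move=> [c Nc]; set N := #|_| in Nc.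
have [||| w wE] := @fpt_lift (fun r => N%:R * r) u.
- by move=> r s rs; rewrite -[r]mul1r -[s]mul1r -Nc mulrAC rs mulrAC.
- by move=> r; exists (c * r); rewrite mulrA Nc mul1r.
- move=> r g; rewrite ract_mul; congr (_ * _).
  by rewrite -[LHS](rmorph_nat (res k (lmul g))).
have [a aE] := tam_unit_free_surj (fpt_res (free_cover X) w).
exists (tr k (free_cover X) a); rewrite tmor_tr aE; apply: fptP => x.
rewrite -wE /= ffunE (eq_bigr (fun=> eqvmap_val w x)) => [|z /eqP <-]; last by rewrite ffunE.
by rewrite -big_set sumr_const card_free_cover_fibre mulr_natl.
Qed.

(** The multiplicative counterpart: u is w^N, the norm of the restriction of w. *)
Lemma tam_unit_surj_nm (u : fpt R X) :
  injective (fun r : R => r ^+ #|[set: gT]|) ->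
  (forall r : R, exists s, s ^+ #|[set: gT]| = r) ->
  exists a, tam_unit X a = u.
Proof.
move=> powI powS; have [| w wE] := fpt_lift u powI powS.
  by move=> r g; rewrite /= /bottom_act rmorphXn.
have [a aE] := tam_unit_free_surj (fpt_res (free_cover X) w).
exists (nm k (free_cover X) a); rewrite tmor_nm aE; apply: fptP => x.
rewrite -wE /= ffunE (eq_bigr (fun=> eqvmap_val w x)) => [|z /eqP <-]; last by rewrite ffunE.
by rewrite -big_set prodr_const card_free_cover_fibre.
Qed.

End Surjective.

End Unit.

(** * Values at the orbits G/H *)

Section OrbitRestriction.
Variables (gT : finGroupType) (k : tambara gT) (H : {group gT}).
Local Notation R := (bottom_gring k).

Fact orbit_res_subproof (a : k (gorbit H)) :
  is_fixed (R := R) H (res k (orbit_proj H) a).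
Proof.
apply/forall_inP => h Hh; apply/eqP; rewrite /= /bottom_act.
have /= <- := res_comp (t := k) (orbit_proj H) (lmul h) a.
by apply: res_ext => g; apply/val_inj; rewrite /= rcosetM (rcoset_id Hh).
Qed.

Definition orbit_res (a : k (gorbit H)) : fixed_ring R H :=
  FixedElt (orbit_res_subproof a).

Fact orbit_res_zmod : zmod_morphism orbit_res.
Proof. by move=> a b; apply/val_inj; rewrite /= rmorphB. Qed.

Fact orbit_res_monoid : monoid_morphism orbit_res.
Proof. by split=> [|a b]; apply/val_inj; rewrite /= ?rmorph1 ?rmorphM. Qed.

HB.instance Definition _ := GRing.isZmodMorphism.Build
  (k (gorbit H)) (fixed_ring R H) orbit_res orbit_res_zmod.
HB.instance Definition _ := GRing.isMonoidMorphism.Build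
  (k (gorbit H)) (fixed_ring R H) orbit_res orbit_res_monoid.

(** An equivariant map on G/H is determined by its value at the coset H, an
    H-fixed element; for the unit this value is the restriction to G/e. *)
Lemma tam_unit_orbit (a : k (gorbit H)) g :
  eqvmap_val (tam_unit k (gorbit H) a) (orbit_proj H g) =
  gring_act R (fixed_val (orbit_res a)) g.
Proof.
rewrite tam_unitE /= /bottom_act.
have /= <- := res_comp (t := k) (orbit_proj H) (lmul g) a.
by apply: res_ext => h; rewrite -[RHS]/(orbit_proj H (g * h)%g) (gmap_eqv (orbit_proj H) g h).
Qed.

Lemma orbit_proj_surj (B : gorbit H) : exists g, orbit_proj H g = B.
Proof.
case: B => B HB; have /rcosetsP[g _ BE] := HB.
by exists g; apply/val_inj; rewrite /= BE.
Qed.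

Lemma orbit_res_bijective :
  injective (tam_unit k (gorbit H)) ->
  (forall u, exists a, tam_unit k (gorbit H) a = u) ->
  bijective orbit_res.
Proof.
move=> unitI unitS; apply: inj_surj_bij => [a b ab|y].
  apply: unitI; apply: fptP => B; have [g <-] := orbit_proj_surj B.
  by rewrite !tam_unit_orbit ab.
have yH h : h \in H -> gring_act R y h = y by move/(forall_inP (fixedP y))/eqP.
pose v g := gring_act R (fixed_val y) g.
have v_coset g : v (repr (H :* g)%g) = v g.
  have /rcosetP[h Hh ->] := mem_repr_rcoset H g.
  by rewrite /v ractM yH.
have uP : equivariant (gset_act (gorbit H))
    [ffun B : gorbit H => v (repr (val B))].
  apply/equivariantP => B a _; have [g <-] := orbit_proj_surj B.
  by rewrite !ffunE /= -rcosetM !v_coset /v ractM.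
have [a aE] := unitS (EqvMap uP); exists a; apply/val_inj.
have := tam_unit_orbit a 1%g; rewrite ract1 aE /= ffunE /= v_coset /v ract1.
exact: esym.
Qed.

End OrbitRestriction.

Theorem theorem1p3 (p n : nat) (gT : finGroupType) (k : tambara gT) :
  prime p ->
  cyclic [set: gT] -> #|[set: gT]| = (p ^ n)%N ->
  field_like k -> clarified k ->
  ~ has_pchar (bottom_gring k) p \/
    perfect_field (fixed_ring (bottom_gring k) [set: gT]) ->
  (exists phi : tmor k (fixed_point_tambara (bottom_gring k)),
      is_unit_map phi /\ tam_iso phi) /\
  (forall (i : nat) (H : {group gT}),
      (i <= n)%N -> #|H| = (p ^ i)%N ->
      exists psi : {rmorphism k (gorbit H) -> fixed_ring (bottom_gring k) H},
        (forall a, fixed_val (psi a) = res k (orbit_proj H) a) /\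
        bijective psi).
Proof.
move=> pp _ cardG kF kC hyp.
have R_field : is_field (bottom_gring k) := clarified_field kF kC.
have unitI X : injective (tam_unit k X).
  by apply: adjunct_injective => //; case: R_field.
have unitS X (u : fpt (bottom_gring k) X) : exists a, tam_unit k X a = u.
  have [p0|p0] := eqVneq (p%:R : bottom_gring k) 0.
    have charRp : has_pchar (bottom_gring k) p by [].
    case: hyp => [//|perf].
    apply: tam_unit_surj_nm; rewrite cardG; first exact: (power_injective R_field charRp).
    exact: (power_surjective R_field charRp).
  apply: tam_unit_surj_tr; have [_ invR] := R_field.
  have [c pc] := invR _ (elimN eqP p0).
  by exists (c ^+ n); rewrite cardG natrX -exprMn pc expr1n.
split; last first.
  move=> i H _ _; exists (@orbit_res _ k H : {rmorphism _ -> _}); split=> //.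
  exact: orbit_res_bijective.
exists (tam_unit k); split; first by move=> X a x; apply: tam_unitE.
exact: tam_iso_of_bijective.
Qed.
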